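(* Consider, for $x\ge0$, the planar piecewise-smooth (Filippov) system $$\dot x=1,\qquad \dot y=-ay-\big[1+(1+\lambda)\cos\pi x\big]\sin\tfrac{\pi x}{2},$$ with $\lambda=\operatorname{sign}(y)$ for $y\ne0$ and $\lambda\in(-1,1)$ on $y=0$. There exists $a_l>0$, $a_l\ll1$, such that for all $a\in(0,a_l)$ this system has a non-sliding periodic solution, which is $4$-periodic (i.e. $y(x+4)=y(x)$) and locally asymptotically stable.
   Context: For $y>0$ the system is $\dot y=-ay-\sin(3\pi x/2)$ and for $y<0$ it is $\dot y=-ay-\sin(\pi x/2)$. The sliding manifold is $\Lambda^L=\{(x,0): x\in(\frac23+2n,\frac43+2n),\ n\in\mathbb{N}\}$, the set of points on $y=0$ where there is $\lambda\in(-1,1)$ making $\dot y=0$; solutions may move along $y=0$ (with $y\equiv0$, $\dot x=1$) only on $\Lambda^L$, and elsewhere on $y=0$ they cross transversally (Filippov convention). A periodic solution is sliding if part of it lies on $\Lambda^L$, and non-sliding otherwise. *)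

(* Defs.v *)
From HB Require Import structures.
From mathcomp Require Import all_boot all_order all_algebra.
From mathcomp Require Import all_classical all_reals all_analysis.
Set Implicit Arguments. Unset Strict Implicit. Unset Printing Implicit Defensive.
Import Order.TTheory GRing.Theory Num.Theory.
Import numFieldNormedType.Exports.
Local Open Scope classical_set_scope.
Local Open Scope ring_scope.

Section Filippov.
Variable R : realType.

Definition rhs (a lam x y : R) : R :=
  - a * y - (1 + (1 + lam) * cos (pi * x)) * sin (pi * x / 2).

(* Filippov set-valued right-hand side: lam = sign y for y <> 0,
   lam in (-1,1) on y = 0. [filippov a x y v] means v is an admissible
   value of y' at the point (x, y). *)
Definition filippov (a x y v : R) : Prop :=
  (0 < y /\ v = rhs a 1 x y) \/
  (y < 0 /\ v = rhs a (-1) x y) \/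
  (y = 0 /\ exists lam : R, -1 < lam < 1 /\ v = rhs a lam x 0).

(* Filippov solution on [x0, +oo): z is absolutely continuous, i.e. the
   indefinite (Lebesgue) integral of some locally integrable g, and
   z'(x) = g(x) lies in the Filippov set at every x >= x0. *)
Definition is_solution (a x0 : R) (z : R -> R) : Prop :=
  exists g : R -> R,
    (forall x, x0 <= x -> filippov a x (z x) (g x)) /\
    (forall x, x0 <= x ->
       lebesgue_measure.-integrable `[x0, x] (fun s => (g s)%:E) /\
       z x = z x0 + \int[lebesgue_measure]_(s in `[x0, x]) g s).

Definition non_sliding (x0 : R) (z : R -> R) : Prop :=
  ~ (exists x1 x2 : R, x0 <= x1 /\ x1 < x2 /\
       forall x, x1 <= x <= x2 -> z x = 0).

Definition four_periodic (y : R -> R) : Prop :=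
  forall x, 0 <= x -> y (x + 4) = y x.

Definition loc_asympt_stable (a : R) (y : R -> R) : Prop :=
  forall x0, 0 <= x0 ->
    (forall eps : R, 0 < eps -> exists delta : R, 0 < delta /\
       forall z, is_solution a x0 z -> `|z x0 - y x0| < delta ->
         forall x, x0 <= x -> `|z x - y x| < eps) /\
    (exists delta : R, 0 < delta /\
       forall z, is_solution a x0 z -> `|z x0 - y x0| < delta ->
         (z x - y x) @[x --> +oo] --> (0 : R)).

End Filippov.

(* Main.v *)
(* For y > 0 the forcing is sin(3 pi x / 2), for y < 0 it is sin(pi x / 2). With
   Gp and Gm primitives of exp(ax) times these, exp(ax) y + Gp (resp. + Gm) is
   constant while y > 0 (resp. y < 0). Modulo 4, both one-sided fields point down
   on (0, 2/3) and up on (10/3, 4), so a trajectory meeting y = 0 only at times th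
   and ps in these intervals crosses it without sliding; it is 4-periodic iff
   Gm th = Gm ps and Gp ps = Gp (th + 4). Such a pair is found by the intermediate
   value theorem: as the common level Gp ps increases from Gp 4 to Gp (10/3), the
   difference Gm th - Gm ps passes from positive to negative (for small a).

   Stability comes from the ratio 1 + 2 cos(pi x) of the two forcings: distances
   between trajectories are divided by it at a down-crossing and multiplied by it
   at an up-crossing. Damping forces th < 4 - ps, and the ratio decreases on
   (0, 2/3), so the crossings do not expand and the damping contracts the return
   map by exp(-4a). *)
Require Import Defs.
From HB Require Import structures.
From mathcomp Require Import all_boot all_order all_algebra.
From mathcomp Require Import all_classical all_reals all_analysis.
From mathcomp Require Import measurable_realfun ring lra.
Set Implicit Arguments. Unset Strict Implicit. Unset Printing Implicit Defensive.
Import Order.TTheory GRing.Theory Num.Theory.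
Import numFieldNormedType.Exports.
Local Open Scope classical_set_scope.
Local Open Scope ring_scope.

(** * Calculus and the two forcing frequencies *)

Section Calculus.
Variable R : realType.
Implicit Types (f df : R -> R) (s t x w a : R).

(** At a = 0 both primitives are 4-periodic and even about 4, so every symmetric pair ps = 4 - th
    closes up. The orbit has to be singled out from this continuum by effects of order a, which is
    why the upper end of the level range needs an explicit estimate and not a limit argument. There
    the fast forcing vanishes (at 10/3 and 2/3), so damping of order a moves the fast crossing by
    order sqrt a, but the slow one only by order a. The bound 1/(600 * 500) on a lets a gain of a
    beat the quadratic loss 144 * 288 * a^2 caused by a shift of 48a.

    Stability is claimed against all Filippov solutions, which are only absolutely continuous and
    not known in advance to be unique. Each solution starting near the orbit is shown to be an
    explicit crossing curve over the rest of the period, for a nearby pair with equal values of Gm.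
    The return map is then compared exactly on such pairs, without linearization. *)

Lemma is_derive_continuous f (d : R) x : is_derive x 1 f d -> {for x, continuous f}.
Proof. by move=> H; apply/differentiable_continuous/derivable1_diffP; exact: ex_derive. Qed.

Lemma is_derive_translate f (d c : R) x :
  is_derive (x + c) 1 f d -> is_derive x 1 (fun u => f (u + c)) d.
Proof. by move=> H; apply: is_derive_eq; rewrite /GRing.scale /=; ring. Qed.

Lemma is_derive_reflect f (d c : R) x :
  is_derive (c - x) 1 f d -> is_derive x 1 (fun u => f (c - u)) (- d).
Proof. by move=> H; apply: is_derive_eq; rewrite /GRing.scale /=; ring. Qed.

Lemma MVT_global f df s t : s < t -> (forall x, is_derive x 1 f (df x)) ->
  exists2 c, s < c < t & f t - f s = df c * (t - s).
Proof.
move=> st H.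
have [|c] := @MVT R f df s t st (fun x _ => H x); last by rewrite in_itv /= => ? ?; exists c.
by apply: continuous_subspaceT => x; exact: (is_derive_continuous (H x)).
Qed.

Lemma lt_of_derive_gt0 f df s t : s < t -> (forall x, is_derive x 1 f (df x)) ->
  (forall x, s < x < t -> 0 < df x) -> f s < f t.
Proof.
move=> st H pos; have [c cst E] := MVT_global st H.
by rewrite -subr_gt0 E mulr_gt0 ?pos ?subr_gt0.
Qed.

Lemma le_of_derive_ge0 f df s t : s <= t -> (forall x, is_derive x 1 f (df x)) ->
  (forall x, s < x < t -> 0 <= df x) -> f s <= f t.
Proof.
rewrite le_eqVlt => /predU1P[-> //|st] H pos; have [c cst E] := MVT_global st H.
by rewrite -subr_ge0 E mulr_ge0 ?pos ?subr_ge0 ?ltW.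
Qed.

Lemma gt_of_derive_lt0 f df s t : s < t -> (forall x, is_derive x 1 f (df x)) ->
  (forall x, s < x < t -> df x < 0) -> f t < f s.
Proof.
move=> st H neg; have [c cst E] := MVT_global st H.
by rewrite -subr_lt0 E nmulr_rlt0 ?neg ?subr_gt0.
Qed.

(* A primitive of exp(ax) sin(wx): along y' = - a y - sin(wx) the quantity
   exp(ax) y + G a w x is constant. *)
Definition G (a w x : R) : R :=
  expR (a * x) * ((a * sin (w * x) - w * cos (w * x)) / (a ^+ 2 + w ^+ 2)).

Lemma is_derive_G a w x : a ^+ 2 + w ^+ 2 != 0 ->
  is_derive x 1 (G a w) (expR (a * x) * sin (w * x)).
Proof.
move=> D0; rewrite /G; apply: is_derive_eq.
rewrite /GRing.scale /=; field.
exact: D0.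
Qed.

Lemma G_shift a w x : (forall u, sin (w * (u + 4)) = sin (w * u)) ->
  (forall u, cos (w * (u + 4)) = cos (w * u)) -> G a w (x + 4) = expR (4 * a) * G a w x.
Proof. by move=> hs hc; rewrite /G hs hc mulrDr expRD [a * 4]mulrC; ring. Qed.

Lemma G_shift_nat a w x (k : nat) : (forall u, sin (w * (u + 4)) = sin (w * u)) ->
  (forall u, cos (w * (u + 4)) = cos (w * u)) ->
  G a w (x + 4 * k%:R) = expR (4 * k%:R * a) * G a w x.
Proof.
move=> hs hc; elim: k => [|k IH]; first by rewrite !mulr0 mul0r expR0 addr0 mul1r.
rewrite (_ : x + _ = x + 4 * k%:R + 4); last by rewrite -natr1; ring.
rewrite G_shift // IH mulrA -expRD; congr (expR _ * _); rewrite -natr1; ring.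
Qed.

(* The frequencies of the forcing for y > 0 and for y < 0. *)
Definition freq_pos : R := 3 * (pi / 2).
Definition freq_neg : R := pi / 2.
Notation wp := freq_pos.
Notation wm := freq_neg.

Lemma wm_ge1 : 1 <= wm. Proof. exact: pihalf_ge1. Qed.
Lemma wm_lt2 : wm < 2. Proof. exact: pihalf_lt2. Qed.
Lemma wpE : wp = 3 * wm. Proof. by []. Qed.

Lemma sin_wm4 u : sin (wm * (u + 4)) = sin (wm * u).
Proof. by rewrite (_ : wm * (u + 4) = wm * u + pi *+ 2) ?sinD2pi // /freq_neg; field. Qed.
Lemma cos_wm4 u : cos (wm * (u + 4)) = cos (wm * u).
Proof. by rewrite (_ : wm * (u + 4) = wm * u + pi *+ 2) ?cosD2pi // /freq_neg; field. Qed.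
Lemma sin_wp4 u : sin (wp * (u + 4)) = sin (wp * u).
Proof.
rewrite (_ : wp * (u + 4) = wp * u + pi *+ 2 + pi *+ 2 + pi *+ 2) ?sinD2pi //.
by rewrite /freq_pos; field.
Qed.
Lemma cos_wp4 u : cos (wp * (u + 4)) = cos (wp * u).
Proof.
rewrite (_ : wp * (u + 4) = wp * u + pi *+ 2 + pi *+ 2 + pi *+ 2) ?cosD2pi //.
by rewrite /freq_pos; field.
Qed.

Lemma sin_wm4n u (k : nat) : sin (wm * (u + 4 * k%:R)) = sin (wm * u).
Proof.
elim: k => [|k IH]; first by rewrite mulr0 addr0.
by rewrite -IH -(sin_wm4 (u + 4 * k%:R)); congr (sin (_ * _)); rewrite -natr1; ring.
Qed.
Lemma sin_wp4n u (k : nat) : sin (wp * (u + 4 * k%:R)) = sin (wp * u).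
Proof.
elim: k => [|k IH]; first by rewrite mulr0 addr0.
by rewrite -IH -(sin_wp4 (u + 4 * k%:R)); congr (sin (_ * _)); rewrite -natr1; ring.
Qed.

(** Triple-angle formula. It splits the factorized forcing of the system into the two frequencies,
    and its first factor is the ratio of forcings that governs stability. *)
Lemma sin_wp x : sin (wp * x) = (1 + 2 * cos (pi * x)) * sin (wm * x).
Proof.
rewrite (_ : pi * x = wm * x *+ 2); last by rewrite /freq_neg; field.
rewrite (_ : wp * x = wm * x *+ 2 + wm * x); last by rewrite /freq_pos /freq_neg; ring.
rewrite sinD sin_mulr2n cos_mulr2n.
by ring.
Qed.

Lemma sin_wm_gt0 x : 0 < x < 2 -> 0 < sin (wm * x).
Proof. move=> /andP[x0 x2]; apply: sin_gt0_pi; rewrite /freq_neg; have := @pi_gt0 R; nra. Qed.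
Lemma sin_wm_lt0 x : 2 < x < 4 -> sin (wm * x) < 0.
Proof.
move=> /andP[x0 x2]; rewrite -(subrK 4 x) sin_wm4 -oppr_gt0 -sinN -mulrN.
by apply: sin_wm_gt0; lra.
Qed.
Lemma sin_wp_gt0 x : 0 < x < 2/3 -> 0 < sin (wp * x).
Proof. move=> /andP[x0 x2]; apply: sin_gt0_pi; rewrite /freq_pos; have := @pi_gt0 R; nra. Qed.
Lemma sin_wp_lt0 x : 10/3 < x < 4 -> sin (wp * x) < 0.
Proof.
move=> /andP[x0 x2]; rewrite -(subrK 4 x) sin_wp4 -oppr_gt0 -sinN -mulrN.
by apply: sin_wp_gt0; lra.
Qed.

Lemma cos_pi_anti x t : 0 <= x -> x <= t -> t <= 1 -> cos (pi * t) <= cos (pi * x).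
Proof.
move=> x0 xt t1; move: xt; rewrite le_eqVlt => /predU1P[->//|xt].
have p0 := @pi_gt0 R.
have ? : 0 <= pi * x by nra.
have ? : pi * x < pi * t by nra.
have ? : pi * t <= pi by nra.
apply: ltW; rewrite ltr_cos ?in_itv /= //; apply/andP; split; lra.
Qed.

(** Since cos(3 * pi/3) = -1, the value c is a root of 4c^3 - 3c + 1 = (c + 1)(2c - 1)^2, and c >
    0. *)
Lemma cos_pi3 : cos (pi / 3) = 1 / 2 :> R.
Proof.
have c0 : 0 < cos (pi / 3 : R).
  by apply: cos_gt0_pihalf; have := @pi_gt0 R; lra.
have : cos ((pi / 3) *+ 2 + pi / 3 : R) = -1.
  by rewrite (_ : _ + _ = pi) ?cospi //; field.
rewrite cosD sin_mulr2n cos_mulr2n.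
have := cos2Dsin2 (pi / 3 : R); move: c0; set c := cos _; set s := sin _ => c0 H E.
have E' : (c ^+ 2 *+ 2 - 1) * c - (c * s) *+ 2 * s + 1 = (c + 1) * (2 * c - 1) ^+ 2.
  have -> : (c * s) *+ 2 * s = 2 * c * (s ^+ 2) by ring.
  have -> : s ^+ 2 = 1 - c ^+ 2 by lra.
  by ring.
have /eqP : (c + 1) * (2 * c - 1) ^+ 2 = 0 by rewrite -E' E; ring.
by rewrite mulf_eq0 expf_eq0 /= => /orP[/eqP h|/eqP h]; lra.
Qed.

Lemma sin_le_self t : 0 <= t -> sin t <= t.
Proof.
move=> t0; rewrite -subr_ge0; pose f (x : R) := x - sin x.
have -> : 0 = f 0 by rewrite /f sin0 subr0.
have fd x : is_derive x 1 f (1 - cos x) by rewrite /f; apply: is_derive_eq.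
by apply: (le_of_derive_ge0 t0 fd) => x _; rewrite subr_ge0 cos_le1.
Qed.

Lemma cos_ge_quadratic t : 0 <= t -> 1 - t ^+ 2 / 2 <= cos t.
Proof.
move=> t0; rewrite -subr_ge0; pose f (x : R) := cos x - (1 - x ^+ 2 / 2).
have -> : 0 = f 0 by rewrite /f cos0; field.
have fd x : is_derive x 1 f (x - sin x).
  rewrite /f; apply: is_derive_eq; rewrite /GRing.scale /=; by field.
apply: (le_of_derive_ge0 t0 fd) => x /andP[x0 _].
by rewrite subr_ge0 sin_le_self // ltW.
Qed.

Lemma sin_ge_half t : 0 <= t <= 1 -> t / 2 <= sin t.
Proof.
move=> /andP[t0 t1]; rewrite -subr_ge0; pose f (x : R) := sin x - x / 2.
have -> : 0 = f 0 by rewrite /f sin0; field.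
have fd x : is_derive x 1 f (cos x - 1 / 2).
  by rewrite /f; apply: is_derive_eq; rewrite /GRing.scale /=; by field.
apply: (le_of_derive_ge0 t0 fd) => x /andP[x0 xt].
have := cos_ge_quadratic (ltW x0); nra.
Qed.

End Calculus.

(** * Crossing times of a periodic orbit *)

Section Crossings.
Variables (R : realType) (a : R).
Hypothesis a_gt0 : 0 < a.
Implicit Types (x t th ps m : R).

Notation wp := (freq_pos R).
Notation wm := (freq_neg R).
Notation Gp := (G a wp).
Notation Gm := (G a wm).

Lemma wp_gt0 : 0 < wp. Proof. have := @wm_ge1 R; rewrite wpE; lra. Qed.
Lemma wm_gt0 : 0 < wm. Proof. have := @wm_ge1 R; lra. Qed.

Lemma is_derive_Gp x : is_derive x 1 Gp (expR (a * x) * sin (wp * x)).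
Proof. by apply: is_derive_G; have := wp_gt0 => ?; apply: lt0r_neq0; nra. Qed.
Lemma is_derive_Gm x : is_derive x 1 Gm (expR (a * x) * sin (wm * x)).
Proof. by apply: is_derive_G; have := wm_gt0 => ?; apply: lt0r_neq0; nra. Qed.

Lemma Gp_cont x : {for x, continuous Gp}.
Proof. exact: is_derive_continuous (is_derive_Gp x). Qed.
Lemma Gm_cont x : {for x, continuous Gm}.
Proof. exact: is_derive_continuous (is_derive_Gm x). Qed.

Lemma Gp4 x : Gp (x + 4) = expR (4 * a) * Gp x.
Proof. by apply: G_shift; [exact: sin_wp4|exact: cos_wp4]. Qed.
Lemma Gm4 x : Gm (x + 4) = expR (4 * a) * Gm x.
Proof. by apply: G_shift; [exact: sin_wm4|exact: cos_wm4]. Qed.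

Lemma Gp_incr x t : 0 <= x -> x < t -> t <= 2/3 -> Gp x < Gp t.
Proof.
move=> x0 xt t1; apply: (lt_of_derive_gt0 xt is_derive_Gp) => u /andP[? ?].
by rewrite mulr_gt0 ?expR_gt0 ?sin_wp_gt0 //; lra.
Qed.
Lemma Gp_decr x t : 10/3 <= x -> x < t -> t <= 4 -> Gp t < Gp x.
Proof.
move=> x0 xt t1; apply: (gt_of_derive_lt0 xt is_derive_Gp) => u /andP[? ?].
by rewrite pmulr_rlt0 ?expR_gt0 ?sin_wp_lt0 //; lra.
Qed.
Lemma Gm_incr x t : 0 <= x -> x < t -> t <= 2 -> Gm x < Gm t.
Proof.
move=> x0 xt t1; apply: (lt_of_derive_gt0 xt is_derive_Gm) => u /andP[? ?].
by rewrite mulr_gt0 ?expR_gt0 ?sin_wm_gt0 //; lra.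
Qed.
Lemma Gm_decr x t : 2 <= x -> x < t -> t <= 4 -> Gm t < Gm x.
Proof.
move=> x0 xt t1; apply: (gt_of_derive_lt0 xt is_derive_Gm) => u /andP[? ?].
by rewrite pmulr_rlt0 ?expR_gt0 ?sin_wm_lt0 //; lra.
Qed.

Lemma Gp_decrW x t : 10/3 <= x -> x <= t -> t <= 4 -> Gp t <= Gp x.
Proof.
by move=> x0; rewrite le_eqVlt => /predU1P[->//|xt] t1; rewrite ltW ?Gp_decr.
Qed.

(* Damping makes the up-crossing happen before the mirror image 4 - th of the
   down-crossing; this asymmetry is what makes the periodic orbit stable. *)
Lemma crossing_order th ps : 0 < th < 2/3 -> 10/3 < ps < 4 ->
  Gp ps = Gp (th + 4) -> th + ps < 4.
Proof.
move=> /andP[th0 th1] /andP[ps0 ps1] E; rewrite ltNge; apply/negP => h.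
pose f x := Gp (x + 4) - Gp (4 - x).
have fd x : is_derive x 1 f
    (expR (a * (x + 4)) * sin (wp * (x + 4)) + expR (a * (4 - x)) * sin (wp * (4 - x))).
  have d1 := is_derive_translate (is_derive_Gp (x + 4)).
  have d2 := is_derive_reflect (is_derive_Gp (4 - x)).
  by rewrite /f; apply: is_derive_eq; rewrite opprK.
(* The sines at 4 + x and 4 - x are opposite, and the exponential weight is larger after time 4. *)
have : f 0 < f th.
  apply: (lt_of_derive_gt0 th0 fd) => x /andP[x0 xt].
  rewrite sin_wp4 addrC [4 - x]addrC sin_wp4 mulrN sinN mulrN addrC -mulrBl.
  rewrite mulr_gt0 ?sin_wp_gt0 ?subr_gt0 ?ltr_expR ?ltr_pM2l //; lra.
rewrite /f -E add0r subr0 subrr => h2.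
have : Gp ps <= Gp (4 - th) by apply: Gp_decrW; lra.
lra.
Qed.

(* The point 2/3 - 48a is a guess: the fast flow (y > 0) started at 10/3 returns to
   y = 0 at 2/3 - O(sqrt a), which is further left for small a. *)
Lemma crossing_estimate : 600 * 500 * a <= 1 ->
  exists2 th, 0 < th < 2/3 & Gp (10/3) <= Gp (th + 4) /\ Gm th < Gm (10/3).
Proof.
have a0 := a_gt0; move=> asmall; exists (2/3 - 48 * a); first by apply/andP; split; lra.
have w1 := @wm_ge1 R; have w2 := @wm_lt2 R; have ww := wpE R.
have -> : 10/3 = (- (2/3)) + 4 :> R by field.
rewrite !Gp4 Gm4 ler_pM2l ?expR_gt0 //; split.
  rewrite /G !mulrA ler_pM2r; last by rewrite invr_gt0; nra.
  have -> : wp * - (2/3) = - pi by rewrite /freq_pos; field.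
  have -> : wp * (2/3 - 48 * a) = pi - wp * (48 * a) by rewrite /freq_pos; field.
  rewrite sinN cosN sinpi cospi sinB cosB sinpi cospi.
  set t := wp * (48 * a).
  have t0 : 0 <= t by rewrite /t; nra.
  have t1 : t <= 288 * a by rewrite /t; nra.
  have c := cos_ge_quadratic t0.
  have s : t / 2 <= sin t by apply: sin_ge_half; apply/andP; split; lra.
  have -> : a * (0 * cos t - -1 * sin t) - wp * (-1 * cos t + 0 * sin t) =
            a * sin t + wp * cos t by ring.
  rewrite oppr0 mulr0 sub0r mulrN1 opprK.
  set E := expR (a * (2/3 - _)); set F := expR (a * - _).
  (* The fast arc lasts 4/3 - 48a, so damping gains at least a factor 1 + a. *)
  have EF : F * (1 + a) <= E.
    have -> : E = F * expR (a * (4/3 - 48 * a)).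
      by rewrite /E /F -expRD; congr expR; field.
    rewrite ler_pM2l ?expR_gt0 //; apply: le_trans (expR_ge1Dx _); nra.
  have F0 : 0 < F by exact: expR_gt0.
  have tt : t ^+ 2 / 2 <= (144 * 288) * a ^+ 2 by nra.
  (* The gain of order a absorbs the loss of order a^2; this is where a must be really small. *)
  have cc : 1 <= (1 + a) * cos t by nra.
  apply: (@le_trans _ _ (F * (wp * ((1 + a) * cos t)))).
    by rewrite ler_pM2l // -[X in X <= _]mulr1 ler_pM2l // wp_gt0.
  have -> : F * (wp * ((1 + a) * cos t)) = F * (1 + a) * (wp * cos t) by ring.
  have c0 : 0 <= cos t by nra.
  apply: (@le_trans _ _ (E * (wp * cos t))).
    by rewrite ler_wpM2r // mulr_ge0 // ltW // wp_gt0.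
  rewrite ler_pM2l ?expR_gt0 // lerDr; nra.
rewrite /G !mulrA ltr_pM2r; last by rewrite invr_gt0; nra.
have -> : wm * - (2/3) = - (pi / 3) by rewrite /freq_neg; field.
have -> : wm * (2/3 - 48 * a) = pi / 3 - wm * (48 * a) by rewrite /freq_neg; field.
rewrite sinN cosN cosB cos_pi3.
set t := wm * (48 * a).
have t0 : 0 <= t by rewrite /t; nra.
have t1 : t <= 96 * a by rewrite /t; nra.
have t2 : t = 48 * a * wm by rewrite /t; ring.
have c := cos_ge_quadratic t0.
have s : t / 2 <= sin t by apply: sin_ge_half; apply/andP; split; lra.
have sig : 1 / 2 <= sin (pi / 3 : R).
  have := cos2Dsin2 (pi / 3 : R); rewrite cos_pi3 => h.
  have : 0 < sin (pi / 3 : R) by apply: sin_gt0_pi; have := @pi_gt0 R; lra.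
  by nra.
have s1 := sin_le1 (pi / 3 : R).
have sb := sin_le1 (pi / 3 - t).
set S := sin (pi / 3 - t) in sb *.
set sg := sin (pi / 3) in sig s1 *.
rewrite -expRD; set E := expR (a * (2/3 - _)); set P := expR _.
have E1 : 1 <= E.
  by rewrite -(expR0 R) ler_expR; nra.
have P0 : 0 < P by exact: expR_gt0.
(* An upper bound on P = exp(10a/3) comes from the lower bound on its inverse. *)
have PQ : P * (1 - 10/3 * a) <= 1.
  have PE : P * expR (- (10/3) * a) = 1.
    by rewrite /P -expRD -[RHS](expR0 R); congr expR; field.
  by rewrite -[X in _ <= X]PE ler_pM2l //; apply: le_trans (expR_ge1Dx _); lra.
have P5 : P <= 1 + 5 * a.
  have : 1 <= (1 + 5 * a) * (1 - 10/3 * a) by nra.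
  by nra.
set C := 1 / 2 * cos t + sg * sin t.
(* The shift contributes at least t/4 - t^2/4 with t/4 = 12 a wm; half of this is kept. *)
have CC : 1/2 + 6 * a * wm <= C by rewrite /C; nra.
have B1 : a * S - wm * C <= a - wm * (1/2 + 6 * a * wm) by nra.
have B2 : a - wm * (1/2 + 6 * a * wm) < - ((1 + 5 * a) * (a + wm / 2)).
  (* The factor 48 is large enough to make this positive knowing only wm >= 1. *)
  have k : 0 < 6 * wm ^+ 2 - (2 + 5 * a + 5/2 * wm) by nra.
  rewrite -subr_gt0 (_ : _ - _ = a * (6 * wm ^+ 2 - (2 + 5 * a + 5/2 * wm))); last by field.
  exact: mulr_gt0.
have X0 : 0 < a + wm / 2 by lra.
have B3 : P * (a + wm / 2) <= (1 + 5 * a) * (a + wm / 2) by rewrite ler_pM2r.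
have B4 : P * (a * sg + wm / 2) <= P * (a + wm / 2).
  by rewrite ler_pM2l // lerD2r -[X in _ <= X]mulr1 ler_pM2l.
have B5 : E * (a * S - wm * C) <= a * S - wm * C.
  have N0 : 0 < (1 + 5 * a) * (a + wm / 2) by apply: mulr_gt0 => //; lra.
  by rewrite -[X in _ <= X]mul1r ler_wnM2r //; lra.
rewrite mulrN (_ : P * _ = - (P * (a * sg + wm / 2))); last by ring.
by lra.
Qed.

End Crossings.

(** * Existence of a periodic pair of crossing times *)

Section Existence.
Variable R : realType.
Implicit Types (f : R -> R) (s t x : R).

(** The inverse is wanted as a continuous function, since the level is the variable of the
    intermediate value argument. *)
Lemma increasing_inverse f s t : s <= t -> continuous f ->
  (forall x u, s <= x -> x < u -> u <= t -> f x < f u) ->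
  exists g : R -> R, {within `[f s, f t], continuous g} /\
    forall c, f s <= c <= f t -> s <= g c <= t /\ f (g c) = c.
Proof.
move=> st fc fi.
have fst : f s <= f t by move: st; rewrite le_eqVlt => /predU1P[->//|st]; rewrite ltW ?fi.
have cf : {within `[s, t], continuous f} by exact: continuous_subspaceT.
have /choice[g gP] : forall c, exists x, f s <= c <= f t -> s <= x <= t /\ f x = c.
  move=> c; have [h|h] := boolP (f s <= c <= f t); last by exists 0.
  have [|x xst xc] := @IVT R f s t c st cf; last by exists x; rewrite in_itv in xst.
  by rewrite (min_idPl fst) (max_idPr fst).
exists g; split => //.
apply: (segment_can_le_continuous st cf) => x; rewrite in_itv /= => /andP[sx xt].
have [| /andP[sg gt] E] := gP (f x).
  apply/andP; split.
    by move: sx; rewrite le_eqVlt => /predU1P[->//|sx]; rewrite ltW ?fi.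
  by move: xt; rewrite le_eqVlt => /predU1P[->//|xt]; rewrite ltW ?fi.
apply/eqP; rewrite eq_le; apply/andP; split; rewrite leNgt; apply/negP => lt.
  by have := fi _ _ sx lt gt; rewrite E ltxx.
by have := fi _ _ sg lt xt; rewrite E ltxx.
Qed.

Variable a : R.
Hypothesis a_gt0 : 0 < a.
Notation wp := (freq_pos R).
Notation wm := (freq_neg R).
Notation Gp := (G a wp).
Notation Gm := (G a wm).

Lemma crossings_exist : 600 * 500 * a <= 1 ->
  exists th ps, [/\ 0 < th < 2/3, 10/3 < ps < 4, Gp ps = Gp (th + 4) & Gm th = Gm ps].
Proof.
move=> asmall.
have [th0 /andP[th00 th01] [est1 est2]] := crossing_estimate a_gt0 asmall.
pose f1 x := Gp (x + 4); pose f2 x := Gp (4 - x).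
have [|||B1 [B1c B1P]] := @increasing_inverse f1 0 (2/3); first by lra.
- by move=> x; exact: is_derive_continuous (is_derive_translate (is_derive_Gp a (x + 4))).
- by move=> x u ? ? ?; rewrite /f1 !Gp4 ltr_pM2l ?expR_gt0 // Gp_incr.
have [|||B2 [B2c B2P]] := @increasing_inverse f2 0 (2/3); first by lra.
- by move=> x; exact: is_derive_continuous (is_derive_reflect (is_derive_Gp a (4 - x))).
- by move=> x u ? ? ?; apply: Gp_decr => //; lra.
have f10 : f1 0 = Gp 4 by rewrite /f1 add0r.
have f20 : f2 0 = Gp 4 by rewrite /f2 subr0.
have f22 : f2 (2/3) = Gp (10/3) by rewrite /f2; congr G; field.
have f12 : f1 th0 < f1 (2/3) by rewrite /f1 !Gp4 ltr_pM2l ?expR_gt0 // Gp_incr //; lra.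
have G43 : Gp 4 < Gp (10/3) by apply: Gp_decr => //; lra.
rewrite f10 in B1c B1P; rewrite f20 f22 in B2c B2P.
(* The levels reached by [f1] cover those of [f2], so [B1] is usable on the whole range; strictness
   later keeps th away from 2/3. *)
have rng : f1 th0 < f1 (2/3) -> Gp (10/3) < f1 (2/3) by move=> ?; apply: le_lt_trans est1 _.
have {}rng := rng f12.
(* c is the common level Gp ps = Gp (th + 4), with th = B1 c and ps = 4 - B2 c. *)
pose H c := Gm (B1 c) - Gm (4 - B2 c).
have Hc : {within `[Gp 4, Gp (10/3)], continuous H}.
  apply: within_continuousB.
    apply: (@within_continuous_comp _ _ _ _ B1 Gm); first by move=> x _; exact: Gm_cont.
    by apply: continuous_subspaceW B1c; apply: subset_itvl; rewrite bnd_simp ltW.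
  apply: (@within_continuous_comp _ _ _ _ B2 (fun x => Gm (4 - x))) => //.
  by move=> x _; exact: is_derive_continuous (is_derive_reflect (is_derive_Gm a (4 - x))).
have b1 c : Gp 4 <= c <= Gp (10/3) -> 0 <= B1 c <= 2/3 /\ Gp (B1 c + 4) = c.
  by move=> /andP[? ?]; apply: B1P; lra.
have b2 c : Gp 4 <= c <= Gp (10/3) -> 0 <= B2 c <= 2/3 /\ Gp (4 - B2 c) = c.
  by move=> /andP[? ?]; apply: B2P; lra.
clear B1P B2P B1c B2c f10 f20 f22 f12.
(* At the lowest level the crossings degenerate to times 0 and 4, and Gm 4 = exp(4a) Gm 0 < Gm 0
   because Gm 0 < 0. *)
have H0 : 0 < H (Gp 4).
  clear est1 est2 rng th00 th01.
  have [|/andP[p1 p2] p3] := b1 (Gp 4); first by lra.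
  have [|/andP[q1 q2] q3] := b2 (Gp 4); first by lra.
  have E1 : B1 (Gp 4) = 0.
    apply/eqP; rewrite eq_le p1 andbT leNgt; apply/negP => h.
    have := Gp_incr a (lexx 0) h p2; rewrite -(ltr_pM2l (expR_gt0 (4 * a))) -!Gp4 p3 add0r.
    by rewrite ltxx.
  have E2 : B2 (Gp 4) = 0.
    apply/eqP; rewrite eq_le q1 andbT leNgt; apply/negP => h.
    have : Gp 4 < Gp (4 - B2 (Gp 4)) by apply: Gp_decr => //; lra.
    by rewrite q3 ltxx.
  rewrite /H E1 E2 subr0 (_ : Gm 4 = expR (4 * a) * Gm 0); last by rewrite -Gm4 add0r.
  rewrite -{1}[Gm 0]mul1r -mulrBl.
  rewrite nmulr_lgt0; first by rewrite subr_lt0 expR_gt1 mulr_gt0.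
  rewrite /G !mulr0 sin0 cos0 mulr0 sub0r mulr1 pmulr_rlt0 ?expR_gt0 //.
  have w := @wm_ge1 R; rewrite mulNr oppr_lt0 divr_gt0 //; nra.
(* Here ps = 10/3. The first half of the estimate puts th at or before [th0], the second half then
   gives the sign. *)
have H1 : H (Gp (10/3)) < 0.
  clear rng H0.
  have [|/andP[p1 p2] p3] := b1 (Gp (10/3)); first by lra.
  have [|/andP[q1 q2] q3] := b2 (Gp (10/3)); first by lra.
  have E2 : B2 (Gp (10/3)) = 2/3.
    apply/eqP; rewrite eq_le q2 /= leNgt; apply/negP => h.
    have : Gp (4 - B2 (Gp (10/3))) < Gp (10/3) by apply: Gp_decr => //; lra.
    by rewrite q3 ltxx.
  have E1 : B1 (Gp (10/3)) <= th0.
    rewrite leNgt; apply/negP => h.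
    have := Gp_incr a (ltW th00) h p2; rewrite -(ltr_pM2l (expR_gt0 (4 * a))) -!Gp4 // p3.
    lra.
  rewrite /H E2 subr_lt0 (_ : 4 - 2/3 = 10/3); last by field.
  apply: le_lt_trans est2; move: E1; rewrite le_eqVlt => /predU1P[->//|E1].
  by rewrite ltW ?Gm_incr //; lra.
(* As [H] is nonzero at both end levels, c lies strictly between them, which makes th > 0 and 10/3 <
   ps < 4 strict. *)
have [|c] := @IVT R H (Gp 4) (Gp (10/3)) 0 (ltW G43) Hc.
  by rewrite ge_min le_max (ltW H0) (ltW H1) !orbT.
rewrite in_itv /= => /andP[]; rewrite le_eqVlt => /predU1P[<-|c0].
  by move=> _ h; move: H0; rewrite h ltxx.
rewrite le_eqVlt => /predU1P[->|c1]; first by move=> h; move: H1; rewrite h ltxx.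
have [|/andP[p1 p2] p3] := b1 c; first by lra.
have [|/andP[q1 q2] q3] := b2 c; first by lra.
move=> /eqP; rewrite subr_eq0 => /eqP HE.
clear H0 H1 Hc b1 b2 est1 est2 th00 th01.
exists (B1 c), (4 - B2 c); split => //.
- rewrite !lt_neqAle p1 p2 !andbT; apply/andP; split; apply/eqP => h.
    by move: p3; rewrite -h add0r => p3; lra.
  by move: p3; rewrite h => p3; rewrite /f1 in rng; lra.
- apply/andP; split; rewrite lt_neqAle; apply/andP; split; try lra; apply/eqP => h.
    by move: q3; rewrite -h => q3; lra.
  by move: q3; rewrite h => q3; lra.
- by rewrite p3 q3.
Qed.

End Existence.

(** * Solutions near the line y = 0 *)

Section Continuity.
Variable R : realType.
Implicit Types (z : R -> R) (s t v : R).

(** Kept in epsilon-delta form so that restriction, negation, reflection and translation of time are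
    immediate. *)
Definition cont_on s t z := forall x, s <= x <= t -> forall e, 0 < e ->
  exists2 d, 0 < d & forall u, s <= u <= t -> `|u - x| < d -> `|z u - z x| < e.

Lemma cont_on_within s t z : {within `[s, t], continuous z} -> cont_on s t z.
Proof.
move=> /subspace_continuousP cz x xst e e0.
have /cvgrPdist_lt/(_ _ e0) : z @ within `[s, t] (nbhs x) --> z x.
  by apply: cz; rewrite /= in_itv.
rewrite near_withinE => /nbhs_ballP[d /= d0 H]; exists d => // u ust ud.
rewrite distrC; apply: H; rewrite /= ?in_itv //.
by rewrite /ball /= distrC.
Qed.

Lemma last_exit s t v z : cont_on s t z -> s <= t -> z s <= v -> v < z t ->
  exists r, [/\ s <= r < t, z r = v & forall x, r < x <= t -> v < z x].
Proof.
move=> cz st zs zt.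
pose A := [set x | s <= x <= t /\ z x <= v].
have As : A s by rewrite /A /= lexx st.
have Aub : ubound A t by move=> x [/andP[]].
have hA : has_sup A by split; [exists s|exists t].
have sr : s <= sup A by apply: ub_le_sup => //; exists t.
have rt : sup A <= t by apply: ge_sup => //; exists s.
have zr : z (sup A) <= v.
  rewrite leNgt; apply/negP => h.
  have h0 : 0 < z (sup A) - v by rewrite subr_gt0.
  have srt : s <= sup A <= t by rewrite sr.
  have [d d0 H] := cz _ srt _ h0.
  have [x Ax xd] := sup_adherent d0 hA.
  have xr : x <= sup A by apply: ub_le_sup => //; exists t.
  have [xst zx] := Ax.
  have : `|z x - z (sup A)| < z (sup A) - v.
    by apply: H => //; rewrite ler0_norm ?subr_le0 //; lra.
  by rewrite ltr_norml => /andP[? _]; lra.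
have {}rt : sup A < t.
  rewrite lt_neqAle rt andbT; apply/eqP => E.
  by move: zr; rewrite E leNgt zt.
have gtv x : sup A < x <= t -> v < z x.
  move=> /andP[rx xt]; rewrite ltNge; apply/negP => h.
  have : x <= sup A by apply: ub_le_sup; [exists t|split => //; rewrite xt andbT; lra].
  by rewrite leNgt rx.
exists (sup A); split; rewrite ?sr //.
apply/eqP; rewrite eq_le zr leNgt; apply/negP => h.
have h0 : 0 < v - z (sup A) by rewrite subr_gt0.
have srt : s <= sup A <= t by rewrite sr ltW.
have [d d0 H] := cz _ srt _ h0.
pose u := Num.min (sup A + d / 2) t.
have ru : sup A < u by rewrite /u lt_min rt andbT; lra.
have ut : u <= t by rewrite /u ge_min lexx orbT.
have ud : u <= sup A + d / 2 by rewrite /u ge_min lexx.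
have : `|z u - z (sup A)| < v - z (sup A).
  by apply: H; [apply/andP; split => //; lra|rewrite ger0_norm; lra].
have := gtv u; rewrite ru ut => /(_ isT) => ?.
by rewrite ltr_norml => /andP[_ ?]; lra.
Qed.

Lemma first_exit s t v z : cont_on s t z -> s <= t -> v < z s -> z t <= v ->
  exists r, [/\ s < r <= t, z r = v & forall x, s <= x < r -> v < z x].
Proof.
move=> cz st zs zt.
(* Time reversal turns a first exit into a last one. *)
have [||||r [/andP[r1 r2] r3 r4]] := @last_exit s t v (fun x => z (s + t - x)).
- move=> x /andP[x1 x2] e e0; 
  have xst : s <= s + t - x <= t by lra.
  have [d d0 H] := cz _ xst e e0.
  exists d => // u /andP[u1 u2] ud; apply: H; first by lra.
  by rewrite (_ : _ - _ = - (u - x)) ?normrN //; ring.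
- by [].
- by rewrite addrAC subrr add0r.
- by rewrite addrK.
exists (s + t - r); split => //; first by lra.
move=> x /andP[x1 x2]; have := r4 (s + t - x).
by rewrite (_ : s + t - (s + t - x) = x); [apply; lra|ring].
Qed.

Lemma pos_lower_bound s t z : s <= t -> continuous z -> (forall x, s <= x <= t -> 0 < z x) ->
  exists2 c, 0 < c & forall x, s <= x <= t -> c <= z x.
Proof.
move=> st cz pos; have [c] := EVT_min st (continuous_subspaceT cz).
rewrite in_itv /= => cst H; exists (z c); first exact: pos.
by move=> x xst; apply: H; rewrite in_itv.
Qed.

End Continuity.

Section Solutions.
Variable R : realType.
Notation mu := (@lebesgue_measure R).
Implicit Types (z g : R -> R) (s t : R).

(** Increments over all subintervals, rather than from a fixed origin, so that the property
    restricts, changes sign and glues. *)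
Definition integral_of s t z g := forall x u, s <= x -> x <= u -> u <= t ->
  mu.-integrable `[x, u] (EFin \o g) /\ z u - z x = \int[mu]_(r in `[x, u]) g r.

Lemma integral_of_opp s t z g :
  integral_of s t z g -> integral_of s t (fun x => - z x) (fun x => - g x).
Proof.
move=> H x u sx xu ut; have [i1 i2] := H x u sx xu ut; split.
  by have := integrableN i1; apply: eq_integrable.
transitivity (-1 * \int[mu]_(r in `[x, u]) g r); first by rewrite -i2; ring.
by rewrite -RintegralZl //; apply: eq_Rintegral => r _; rewrite mulN1r.
Qed.

Lemma integral_of_solution x0 z g : (forall x, x0 <= x ->
    mu.-integrable `[x0, x] (fun s => (g s)%:E) /\
    z x = z x0 + \int[mu]_(s in `[x0, x]) g s) ->
  forall t, integral_of x0 t z g.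
Proof.
move=> H t x u x0x xu ut.
have [i1 i2] := H u (le_trans x0x xu); have [i3 i4] := H x x0x.
split.
  by apply: integrableS i1 => //; apply: subset_itvr; rewrite bnd_simp.
rewrite i2 i4 opprD addrACA subrr add0r.
rewrite Rintegral_itvB ?bnd_simp //.
rewrite Rintegral_itv_obnd_cbnd //.
apply: integrableS i1 => //; apply: subset_itvr; rewrite bnd_simp //.
Qed.

Lemma integral_of_le s t z g c : s <= t -> integral_of s t z g ->
  (forall x, s <= x <= t -> g x <= c) -> z t - z s <= c * (t - s).
Proof.
move=> st H le; have [i1 ->] := H s t (lexx s) st (lexx t).
have -> : c * (t - s) = \int[mu]_(r in `[s, t]) (fun=> c) r.
  rewrite Rintegral_cst //= lebesgue_measure_itv /= lte_fin.
  move: st; rewrite le_eqVlt => /predU1P[->|st]; first by rewrite ltxx subrr.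
  by rewrite st.
apply: le_Rintegral => //.
  by apply: continuous_compact_integrable; [exact: segment_compact|apply: cst_continuous].
Qed.

(* Near the line y = 0 both one-sided fields point downwards, so solutions can
   only cross that line, and only once. *)
Lemma transversal_crossing s t z g eta c : s < t -> 0 < eta -> 0 < c ->
  cont_on s t z -> integral_of s t z g ->
  (forall x, s <= x <= t -> - eta < z x -> g x <= - c) -> z s <= 0 -> z t < 0.
Proof.
move=> st eta0 c0 cz iz gc zs; rewrite ltNge; apply/negP => zt.
have main r : s <= r -> r < t -> z r <= 0 -> (forall x, r <= x <= t -> - eta < z x) -> False.
  move=> sr rt zr h.
  have : z t - z r <= - c * (t - r).
    apply: (@integral_of_le _ _ _ g); first exact: ltW.
      by move=> x u rx xu ut; apply: iz => //; exact: le_trans rx.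
    move=> x /andP[rx xt].
    by apply: gc; [rewrite xt andbT; exact: le_trans rx|by apply: h; rewrite rx].
  by nra.
(* If z dips to - eta/2, it stays in the strip after its last exit from that level, where z <= 0
   still holds. Otherwise it is in the strip from s on. In both cases [main] applies. *)
have [[x /andP[sx xt] zx]|H] := pselect (exists2 x, s <= x <= t & z x <= - (eta / 2)).
  have [||||r [/andP[r1 r2] r3 r4]] := @last_exit _ x t (- (eta / 2)) z; try lra.
    move=> y /andP[y1 y2] e e0.
    have syt : s <= y <= t by apply/andP; split => //; lra.
    have [d d0 H] := cz y syt e e0.
    by exists d => // u /andP[u1 u2]; apply: H; apply/andP; split => //; lra.
  apply: (main r); try lra.
  move=> y /andP[]; rewrite le_eqVlt => /predU1P[<- _|ry yt]; first by lra.
  by have := r4 y; rewrite ry yt => /(_ isT); lra.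
apply: (main s) => // x xst; rewrite ltNge; apply/negP => h; apply: H.
by exists x => //; lra.
Qed.

End Solutions.

(** * First integrals and crossing rules of Filippov solutions *)

Section Flow.
Variables (R : realType) (a : R).
Notation mu := (@lebesgue_measure R).
Implicit Types (z g : R -> R) (s t : R).
Notation wp := (freq_pos R).
Notation wm := (freq_neg R).
Notation Gp := (G a wp).
Notation Gm := (G a wm).

(* All that is used of a solution below; unlike the integral equation, these
   rules are visibly invariant under translation of time by 4. *)
Definition obeys_flow x0 z : Prop :=
  [/\ forall t, cont_on x0 t z,
      forall s t, x0 <= s -> s < t -> (forall x, s < x < t -> 0 < z x) ->
        expR (a * t) * z t + Gp t = expR (a * s) * z s + Gp s,
      forall s t, x0 <= s -> s < t -> (forall x, s < x < t -> z x < 0) ->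
        expR (a * t) * z t + Gm t = expR (a * s) * z s + Gm s,
      forall (k : nat) s t, x0 <= s -> 4 * k%:R < s -> s < t -> t < 4 * k%:R + 2/3 ->
        z s <= 0 -> z t < 0 &
      forall (k : nat) s t, x0 <= s -> 4 * k%:R + 10/3 < s -> s < t -> t < 4 * k%:R + 4 ->
        0 <= z s -> 0 < z t].

Lemma rhs_pos x y : rhs a 1 x y = - a * y - sin (wp * x).
Proof.
rewrite /rhs sin_wp (_ : pi * x / 2 = wm * x); first by ring.
by rewrite /freq_neg; field.
Qed.

Lemma rhs_neg x y : rhs a (-1) x y = - a * y - sin (wm * x).
Proof.
rewrite /rhs (_ : 1 + -1 = 0) ?mul0r ?addr0 ?mul1r; last by ring.
by congr (_ - sin _); rewrite /freq_neg; field.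
Qed.

(** On y = 0 the admissible slopes are convex combinations of the two one-sided fields, so where
    these have a common sign, no slope can vanish. *)
Lemma rhs_zero lam x :
  rhs a lam x 0 = - ((1 + lam) / 2 * sin (wp * x) + (1 - lam) / 2 * sin (wm * x)).
Proof.
rewrite /rhs sin_wp (_ : pi * x / 2 = wm * x); last by rewrite /freq_neg; field.
by field.
Qed.

(** On the interval where g is given by the formula, continuity of z makes g continuous. The
    fundamental theorem then upgrades z to a classical solution, along which the claimed quantity
    has zero derivative. *)
Lemma first_integral w x0 z g s t : a ^+ 2 + w ^+ 2 != 0 ->
  (forall x, x0 <= x -> mu.-integrable `[x0, x] (EFin \o g) /\
     z x = z x0 + \int[mu]_(r in `[x0, x]) g r) ->
  x0 <= s -> s < t -> (forall x, s < x < t -> g x = - a * z x - sin (w * x)) ->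
  expR (a * t) * z t + G a w t = expR (a * s) * z s + G a w s.
Proof.
move=> D0 iz x0s st gE.
have x0t : x0 < t by exact: le_lt_trans st.
pose F x := \int[mu]_(r in `[x0, x]) g r.
pose zz x := z x0 + F x.
have zE x : x0 <= x -> z x = zz x by move=> /iz[].
have [it _] := iz t (ltW x0t).
have Fc : {within `[x0, t], continuous F}.
  exact: (parameterized_integral_continuous (ltW x0t) it).
have zzc : {within `[x0, t], continuous zz}.
  by move=> x; apply: cvgD; [exact: cvg_cst|exact: Fc].
have zzd x : s < x < t -> is_derive x 1 zz (- a * zz x - sin (w * x)).
  move=> /andP[sx xt].
  have x0x : x0 < x by exact: le_lt_trans sx.
  have gx : g x = - a * zz x - sin (w * x) by rewrite gE ?sx // zE // ltW.
  have zzcx : {for x, continuous zz}.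
    by apply: (within_continuous_continuous x0t zzc); rewrite in_itv /= x0x.
  have gc : {for x, continuous g}.
    rewrite /prop_for /continuous_at gx.
    have hc : - a * zz u - sin (w * u) @[u --> x] --> - a * zz x - sin (w * x).
      apply: cvgB; first by apply: cvgM; [exact: cvg_cst|exact: zzcx].
      apply: (@is_derive_continuous _ (fun u => sin (w * u)) (cos (w * x) * w)).
      by apply: is_derive_eq; rewrite /GRing.scale /=; ring.
    apply: cvg_trans hc; apply: near_eq_cvg.
    have : \forall u \near x, u \in `]s, t[ by apply: near_in_itvoo; rewrite in_itv /= sx.
    apply: filterS => u; rewrite in_itv /= => /andP[su ut].
    by rewrite gE ?su // zE //; apply: ltW; exact: le_lt_trans su.
  have [Fd FE] := continuous_FTC1_closed xt it x0x gc.
  have Fd' := derivableP Fd; rewrite -derive1E FE in Fd'.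
  by have := is_deriveD (is_derive_cst (z x0) x 1) Fd'; rewrite add0r gx.
have x0t' := ltW x0t; rewrite !zE //.
pose f x := expR (a * x) * zz x + G a w x.
have fd x : x \in `]s, t[ -> is_derive x 1 f 0.
  rewrite in_itv /= => /zzd zd; have gd := is_derive_G x D0.
  by rewrite /f; apply: is_derive_eq; rewrite /GRing.scale /=; ring.
have fc : {within `[s, t], continuous f}.
  have zs : {within `[s, t], continuous zz}.
    by apply: continuous_subspaceW zzc; apply: subset_itvr; rewrite bnd_simp.
  move=> x; apply: cvgD; first apply: cvgM; [|exact: zs|].
    apply: (@continuous_subspaceT _ _ _ (fun u => expR (a * u))) => u.
    apply: (@is_derive_continuous _ _ (expR (a * u) * a)).
    by apply: is_derive_eq; rewrite /GRing.scale /=; ring.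
  apply: (@continuous_subspaceT _ _ _ (G a w)) => u.
  exact: (is_derive_continuous (is_derive_G u D0)).
have [c _] := MVT_segment (ltW st) fd fc.
by rewrite mul0r => /eqP; rewrite subr_eq0 => /eqP.
Qed.

Lemma continuous_sinM (w : R) : continuous (fun x : R => sin (w * x)).
Proof.
move=> x; apply: (@is_derive_continuous _ (fun u => sin (w * u)) (cos (w * x) * w)).
by apply: is_derive_eq; rewrite /GRing.scale /=; ring.
Qed.

Lemma is_solution_obeys_flow x0 z : 0 < a -> is_solution a x0 z -> obeys_flow x0 z.
Proof.
move=> a0 [g [gf iz]].
have ig := integral_of_solution iz.
have cz t : cont_on x0 t z.
  have [x0t|tx0] := leP x0 t; last by move=> x; lra.
  apply: cont_on_within => //.
  have [it _] := iz t x0t.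
  apply: (@subspace_eq_continuous _ _ _ (fun x => z x0 + \int[mu]_(r in `[x0, x]) g r)).
    by move=> x; rewrite inE /= in_itv /= => /andP[x0x _]; have [_ E] := iz x x0x; rewrite /= -E.
  move=> x; apply: cvgD; [exact: cvg_cst|].
  exact: (parameterized_integral_continuous x0t it).
have w1 := wp_gt0 R; have w2 := wm_gt0 R.
have czs s t : x0 <= s -> cont_on s t z.
  move=> x0s x /andP[sx xt] e e0.
  have xx : x0 <= x <= t by rewrite xt andbT; exact: le_trans sx.
  have [d d0 H] := cz t x xx e e0; exists d => // u /andP[su ut]; apply: H.
  by rewrite ut andbT; exact: le_trans su.
have igs s t : x0 <= s -> integral_of s t z g.
  by move=> x0s x u sx; apply: (ig t); exact: le_trans sx.
have zone s t : x0 <= s -> forall x, s <= x <= t -> x0 <= x.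
  by move=> h x /andP[h' _]; exact: le_trans h'.
split => //.
- move=> s t x0s st zp; apply: (first_integral _ iz x0s st); first by apply: lt0r_neq0; nra.
  move=> x sxt; have x0x : x0 <= x by apply: le_trans x0s (ltW _); case/andP: sxt.
  have := zp x sxt => zx.
  have [[_ ->]|[[h _]|[h _]]] := gf x x0x; [exact: rhs_pos|lra|lra].
- move=> s t x0s st zp; apply: (first_integral _ iz x0s st); first by apply: lt0r_neq0; nra.
  move=> x sxt; have x0x : x0 <= x by apply: le_trans x0s (ltW _); case/andP: sxt.
  have := zp x sxt => zx.
  have [[h _]|[[_ ->]|[h _]]] := gf x x0x; [lra|exact: rhs_neg|lra].
- move=> k s t x0s ks st tk zs.
  have shift (x : R) : x = x - 4 * k%:R + 4 * k%:R by ring.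
  have [c1 c10 H1] : exists2 c, 0 < c & forall x, s <= x <= t -> c <= sin (wp * x).
    apply: pos_lower_bound (ltW st) _ _; first exact: continuous_sinM.
    by move=> x /andP[? ?]; rewrite (shift x) sin_wp4n sin_wp_gt0 //; lra.
  have [c2 c20 H2] : exists2 c, 0 < c & forall x, s <= x <= t -> c <= sin (wm * x).
    apply: pos_lower_bound (ltW st) _ _; first exact: continuous_sinM.
    by move=> x /andP[? ?]; rewrite (shift x) sin_wm4n sin_wm_gt0 //; lra.
  pose c := Num.min c1 c2.
  have c0 : 0 < c by rewrite lt_min c10.
  have cc1 : c <= c1 by rewrite ge_min lexx.
  have cc2 : c <= c2 by rewrite ge_min lexx orbT.
  (* In the strip y > - c/(2a) the damping term is below c/2, so it takes away less than half of the
     forcing c. *)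
  apply: (@transversal_crossing _ s t z g (c / 2 / a) (c / 2)) => //;
    [by rewrite !divr_gt0|by rewrite divr_gt0|exact: czs|exact: igs|].
  move=> x sxt; rewrite ltrNl ltr_pdivlMr // => zx.
  have x0x := zone _ _ x0s x sxt; have := H1 x sxt; have := H2 x sxt.
  have [[h ->]|[[h ->]|[h [lam [/andP[l1 l2] ->]]]]] := gf x x0x => e2 e1.
  + by rewrite rhs_pos; nra.
  + by rewrite rhs_neg; nra.
  + by rewrite rhs_zero; nra.
- move=> k s t x0s ks st tk zs.
  have shift (x : R) : x = x - 4 * k%:R + 4 * k%:R by ring.
  have [c1 c10 H1] : exists2 c, 0 < c & forall x, s <= x <= t -> c <= - sin (wp * x).
    apply: pos_lower_bound (ltW st) _ _.
      by move=> x; apply: cvgN; exact: continuous_sinM.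
    by move=> x /andP[? ?]; rewrite (shift x) sin_wp4n oppr_gt0 sin_wp_lt0 //; lra.
  have [c2 c20 H2] : exists2 c, 0 < c & forall x, s <= x <= t -> c <= - sin (wm * x).
    apply: pos_lower_bound (ltW st) _ _.
      by move=> x; apply: cvgN; exact: continuous_sinM.
    by move=> x /andP[? ?]; rewrite (shift x) sin_wm4n oppr_gt0 sin_wm_lt0 //; lra.
  pose c := Num.min c1 c2.
  have c0 : 0 < c by rewrite lt_min c10.
  have cc1 : c <= c1 by rewrite ge_min lexx.
  have cc2 : c <= c2 by rewrite ge_min lexx orbT.
  (* An up-crossing of z is a down-crossing of - z. *)
  rewrite -oppr_lt0.
  apply: (@transversal_crossing _ s t (fun x => - z x) (fun x => - g x) (c / 2 / a) (c / 2)) => //;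
    [by rewrite !divr_gt0|by rewrite divr_gt0| |exact/integral_of_opp/igs| |by rewrite oppr_le0].
    move=> x xst e e0; have [d d0 H] := czs s t x0s x xst e e0.
    by exists d => // u ust ud; rewrite -opprD normrN; exact: H.
  move=> x sxt; rewrite ltrN2 ltr_pdivlMr // lerN2 => zx.
  have x0x := zone _ _ x0s x sxt; have := H1 x sxt; have := H2 x sxt.
  have [[h ->]|[[h ->]|[h [lam [/andP[l1 l2] ->]]]]] := gf x x0x => e2 e1.
  + by rewrite rhs_pos; nra.
  + by rewrite rhs_neg; nra.
  + by rewrite rhs_zero; nra.
Qed.

End Flow.

(** * Trajectories over one period *)

Section Trajectories.
Variables (R : realType) (a : R).
Implicit Types (z f : R -> R) (s t th ps x e : R).
Notation wp := (freq_pos R).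
Notation wm := (freq_neg R).
Notation Gp := (G a wp).
Notation Gm := (G a wm).

(* The trajectory crossing y = 0 downwards at th and upwards at ps. *)
Definition crossing_curve th ps x : R := expR (- (a * x)) *
  (if x <= th then Gp th - Gp x else if x <= ps then Gm th - Gm x else Gp ps - Gp x).

Lemma obeys_flow_later x0 s z : x0 <= s -> obeys_flow a x0 z -> obeys_flow a s z.
Proof.
move=> x0s [H1 H2 H3 H4 H5]; split.
- move=> t x /andP[sx xt] e e0.
  have xx : x0 <= x <= t by rewrite xt andbT; exact: le_trans sx.
  have [d d0 H] := H1 t x xx e e0; exists d => // u /andP[su ut]; apply: H.
  by rewrite ut andbT; exact: le_trans su.
- by move=> u t su; apply: H2; exact: le_trans su.
- by move=> u t su; apply: H3; exact: le_trans su.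
- by move=> k u t su; apply: H4; exact: le_trans su.
- by move=> k u t su; apply: H5; exact: le_trans su.
Qed.

(** Translation by 4k multiplies exp(ax) and both primitives by the same factor, which cancels from
    the first integrals. *)
Lemma obeys_flow_shift (k : nat) x0 z : obeys_flow a (x0 + 4 * k%:R) z ->
  obeys_flow a x0 (fun x => z (x + 4 * k%:R)).
Proof.
set c := 4 * k%:R => -[H1 H2 H3 H4 H5].
have ex u : expR (a * (u + c)) = expR (c * a) * expR (a * u).
  by rewrite -expRD; congr expR; ring.
have gp u : Gp (u + c) = expR (c * a) * Gp u.
  by apply: G_shift_nat; [exact: sin_wp4|exact: cos_wp4].
have gm u : Gm (u + c) = expR (c * a) * Gm u.
  by apply: G_shift_nat; [exact: sin_wm4|exact: cos_wm4].
have e0 : expR (c * a) != 0 by rewrite gt_eqF ?expR_gt0.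
have fac A v B : expR (c * a) * A * v + expR (c * a) * B = expR (c * a) * (A * v + B).
  by rewrite mulrDr mulrA.
split.
- move=> t x xt e e_gt0; have xt' : x0 + c <= x + c <= t + c by rewrite !lerD2r.
  have [d d0 H] := H1 (t + c) _ xt' e e_gt0; exists d => // u ut ud.
  by apply: H; rewrite ?lerD2r // opprD addrACA subrr addr0.
- move=> s t s0 st zp; have := H2 (s + c) (t + c).
  rewrite lerD2r ltrD2r !ex !gp.
  rewrite !fac => /(_ s0 st) E; apply: (mulfI e0); apply: E.
  by move=> x /andP[sx xt]; rewrite -(subrK c x); apply: zp; lra.
- move=> s t s0 st zp; have := H3 (s + c) (t + c).
  rewrite lerD2r ltrD2r !ex !gm.
  rewrite !fac => /(_ s0 st) E; apply: (mulfI e0); apply: E.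
  by move=> x /andP[sx xt]; rewrite -(subrK c x); apply: zp; lra.
- move=> j s t s0 js st tj zs; have jk : 4 * (j + k)%:R = 4 * j%:R + c by rewrite natrD mulrDr.
  by apply: (H4 (j + k)%N (s + c)); rewrite ?jk //; lra.
- move=> j s t s0 js st tj zs; have jk : 4 * (j + k)%:R = 4 * j%:R + c by rewrite natrD mulrDr.
  by apply: (H5 (j + k)%N (s + c)); rewrite ?jk //; lra.
Qed.

Lemma eq_damped x (v C D : R) : expR (a * x) * v + D = C -> v = expR (- (a * x)) * (C - D).
Proof. by move=> <-; rewrite addrK mulrA -expRD addNr expR0 mul1r. Qed.

Lemma damped_eq x (v C D : R) : v = expR (- (a * x)) * (C - D) -> expR (a * x) * v + D = C.
Proof. by move=> ->; rewrite mulrA -expRD addrN expR0 mul1r subrK. Qed.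

Lemma trajectory_up s z : 10/3 < s < 4 -> obeys_flow a s z -> 0 <= z s ->
  forall x, s <= x <= 4 -> expR (a * x) * z x + Gp x = expR (a * s) * z s + Gp s.
Proof.
move=> /andP[s1 s2] [_ H2 _ _ H5] zs x /andP[]; rewrite le_eqVlt => /predU1P[<-//|sx] x4.
apply: H2 => // u /andP[su ux]; apply: (H5 0%N s) => //; rewrite mulr0; lra.
Qed.

(** A return to 0 at some r < ps would force Gm r = Gm ps. This is impossible after time 2, where Gm
    decreases, and before it, where Gm increases from Gm s > Gm ps. *)
Lemma trajectory_mid s ps z : 0 < s -> s < ps -> 10/3 < ps < 4 -> obeys_flow a s z ->
  z s < 0 -> expR (a * s) * z s + Gm s = Gm ps ->
  forall x, s <= x <= ps -> expR (a * x) * z x + Gm x = Gm ps.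
Proof.
move=> s0 sps /andP[p1 p2] [H1 _ H3 _ _] zs E.
have es := expR_gt0 (a * s).
have neg x : s <= x -> x < ps -> z x < 0.
  move=> sx xps; rewrite ltNge; apply/negP => zx.
  have [||||r [/andP[r1 r2] r3 r4]] := @first_exit _ s x 0 (fun u => - z u) => //.
  - by move=> u su e e0; have [d d0 H] := H1 x u su e e0; exists d => // v sv vu;
      rewrite -opprD normrN; exact: H.
  - by rewrite oppr_gt0.
  - by rewrite oppr_le0.
  have := H3 s r (lexx s) r1; rewrite E.
  have -> : z r = 0 by apply/eqP; rewrite -oppr_eq0 r3.
  rewrite mulr0 add0r => /(_ _)/wrap[|Er].
    by move=> u /andP[su ur]; rewrite -oppr_gt0; apply: r4; rewrite ur ltW.
  have [r5|r5] := leP 2 r.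
    have : Gm ps < Gm r by apply: Gm_decr => //; lra.
    by rewrite Er ltxx.
  have : Gm s < Gm r by apply: Gm_incr => //; lra.
  rewrite Er -E; nra.
move=> x /andP[]; rewrite le_eqVlt => /predU1P[<-//|sx] x4.
rewrite -E; apply: H3 => // u /andP[su ux]; apply: neg; [exact: ltW|exact: lt_le_trans x4].
Qed.

(** An earlier zero r would have Gp r = Gp th, against monotonicity of Gp up to 2/3. *)
Lemma trajectory_down s th z : 0 <= s -> s <= th -> th < 2/3 -> obeys_flow a s z ->
  expR (a * s) * z s + Gp s = Gp th ->
  forall x, s <= x <= th -> expR (a * x) * z x + Gp x = Gp th.
Proof.
move=> s0; rewrite le_eqVlt => /predU1P[->|sth] t1 [H1 H2 _ _ _] E.
  by move=> x; rewrite -eq_le => /eqP <-.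
have es := expR_gt0 (a * s).
have zs : 0 < z s by have := @Gp_incr R a s th s0 sth (ltW t1); rewrite -E; nra.
have pos x : s <= x -> x < th -> 0 < z x.
  move=> sx xth; rewrite ltNge; apply/negP => zx.
  have [r [/andP[r1 r2] r3 r4]] := first_exit (H1 x) sx zs zx.
  have := H2 s r (lexx s) r1; rewrite E r3 mulr0 add0r => /(_ _)/wrap[|Er].
    by move=> u /andP[su ur]; apply: r4; rewrite ur ltW.
  have : Gp r < Gp th by apply: Gp_incr; lra.
  by rewrite Er ltxx.
move=> x /andP[]; rewrite le_eqVlt => /predU1P[<-//|sx] x4.
rewrite -E; apply: H2 => // u /andP[su ux]; apply: pos; [exact: ltW|exact: lt_le_trans x4].
Qed.

(** Only the slow arc between the crossings is matched. Without the closing condition such pairs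
    form a one-parameter family, which describes the solutions near the orbit. *)
Definition crossing_pair th ps := [/\ 0 < th < 2/3, 10/3 < ps < 4 & Gm th = Gm ps].

(** Forward uniqueness along crossing curves: off y = 0 the first integrals determine z, and at the
    crossings the transversality rules fix the side on which it continues. *)
Lemma trajectory s th ps z : 0 <= s < 4 -> crossing_pair th ps -> obeys_flow a s z ->
  z s = crossing_curve th ps s -> forall x, s <= x <= 4 -> z x = crossing_curve th ps x.
Proof.
move=> /andP[s0 s4] [/andP[t0 t1] /andP[p1 p2] E] flow.
have from_up u : ps <= u -> u < 4 -> obeys_flow a u z -> z u = crossing_curve th ps u ->
    forall x, u <= x <= 4 -> z x = crossing_curve th ps x.
  move=> pu u4 fl zu x /andP[ux x4].
  have zuE : expR (a * u) * z u + Gp u = Gp ps.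
    apply: damped_eq; rewrite zu /crossing_curve ifF; last by apply/negbTE; rewrite -ltNge; lra.
    case: ifP => // up; have -> : u = ps by apply/eqP; rewrite eq_le up pu.
    by rewrite E !subrr.
  have zu0 : 0 <= z u.
    have : Gp u <= Gp ps by apply: Gp_decrW; lra.
    have := expR_gt0 (a * u); rewrite -zuE; nra.
  have xu : u <= x <= 4 by rewrite ux x4.
  have := @trajectory_up u z _ fl zu0 x xu; rewrite zuE => /(_ _)/wrap[|/eq_damped ->].
    by apply/andP; split; lra.
  rewrite /crossing_curve ifF; last by apply/negbTE; rewrite -ltNge; lra.
  case: ifP => // xp; have -> : x = ps by apply/eqP; rewrite eq_le xp (le_trans pu).
  by rewrite E !subrr.
have from_mid u : th < u -> u < 4 -> obeys_flow a u z -> z u = crossing_curve th ps u ->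
    forall x, u <= x <= 4 -> z x = crossing_curve th ps x.
  move=> tu u4 fl zu x /andP[ux x4].
  have [pu|up] := leP ps u; first by apply: (from_up u); rewrite ?ux.
  have zuE : expR (a * u) * z u + Gm u = Gm ps.
    by rewrite -E; apply: damped_eq; rewrite zu /crossing_curve leNgt tu /= ltW.
  have zu0 : z u < 0.
    have : Gm ps < Gm u.
      have [u2|u2] := leP u 2; first by rewrite -E; apply: Gm_incr => //; lra.
      by apply: Gm_decr => //; lra.
    have := expR_gt0 (a * u); rewrite -zuE; nra.
  have mid := @trajectory_mid u ps z _ up _ fl zu0 zuE.
  have {}mid v : u <= v <= ps -> z v = crossing_curve th ps v.
    move=> /andP[uv vp]; have /eq_damped -> : expR (a * v) * z v + Gm v = Gm ps.
      by apply: mid; rewrite ?uv ?vp //; lra.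
    by rewrite /crossing_curve leNgt (lt_le_trans tu uv) /= vp E.
  have [xp|px] := leP x ps; first by apply: mid; rewrite ux.
  apply: (from_up ps); rewrite ?lexx //.
  - exact: obeys_flow_later (ltW up) fl.
  - by apply: mid; rewrite lexx ltW.
  - by rewrite x4 ltW.
move=> zs; have [sth|ths] := leP s th; last by apply: (from_mid s).
have zsE : expR (a * s) * z s + Gp s = Gp th by apply: damped_eq; rewrite zs /crossing_curve sth.
have down := trajectory_down s0 sth t1 flow zsE.
move=> x /andP[sx x4]; have [xth|thx] := leP x th.
  by rewrite /crossing_curve xth; apply: eq_damped; apply: down; rewrite sx.
have zth : z th = 0.
  have := down th; rewrite sth lexx => /(_ isT)/(canRL (addrK _)); rewrite subrr => /eqP.
  by rewrite mulf_eq0 gt_eqF ?expR_gt0 //= => /eqP.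
have fth := obeys_flow_later sth flow.
have near u : th < u < 2/3 -> z u = crossing_curve th ps u.
  move=> /andP[tu u1]; have [_ _ H3 H4 _] := fth.
  rewrite /crossing_curve leNgt tu /= ifT; last by lra.
  apply: eq_damped; rewrite (H3 th u (lexx th) tu) ?zth ?mulr0 ?add0r // => v /andP[tv vu].
  by apply: (H4 0%N th) => //; rewrite ?mulr0 ?zth ?lexx //; lra.
have [x1|x1] := ltP x (2/3); first by apply: near; rewrite thx.
(* [from_mid] must start strictly after th, where z is already negative. *)
apply: (from_mid ((th + 2/3) / 2)); try lra.
- by apply: obeys_flow_later fth; lra.
- by apply: near; lra.
Qed.

End Trajectories.

(** * Nearby values and nearby crossing pairs *)

Section LocalInverse.
Variable R : realType.
Implicit Types (f : R -> R) (x e c : R).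

Lemma local_inverse_incr f lo hi x e : lo < x < hi -> continuous f ->
  (forall u v, lo <= u -> u < v -> v <= hi -> f u < f v) -> 0 < e ->
  exists2 d, 0 < d & forall c, `|c - f x| < d ->
    exists x', [/\ lo < x' < hi, `|x' - x| < e & f x' = c].
Proof.
move=> /andP[lx xh] fc fi e0.
(* Two points around x, within e/2 of it and strictly inside the monotonicity interval, between
   which every level close to f x is attained. *)
pose l := Num.max (x - e / 2) ((lo + x) / 2); pose r := Num.min (x + e / 2) ((x + hi) / 2).
have l1 : x - e / 2 <= l by rewrite le_max lexx.
have l2 : (lo + x) / 2 <= l by rewrite le_max lexx orbT.
have l3 : l < x by rewrite gt_max; apply/andP; split; lra.
have r1 : r <= x + e / 2 by rewrite ge_min lexx.
have r2 : r <= (x + hi) / 2 by rewrite ge_min lexx orbT.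
have r3 : x < r by rewrite lt_min; apply/andP; split; lra.
have fl : f l < f x by apply: fi; lra.
have fr : f x < f r by apply: fi; lra.
exists (Num.min (f x - f l) (f r - f x)); first by rewrite lt_min !subr_gt0 fl.
move=> c; rewrite lt_min !ltr_norml => /andP[/andP[c1 _] /andP[_ c2]].
have [||x'] := @IVT R f l r c _ (continuous_subspaceT fc); first by lra.
  by rewrite ge_min le_max; apply/andP; split; apply/orP; [left|right]; lra.
rewrite in_itv /= => /andP[x1 x2] fx; exists x'; split => //; first by apply/andP; split; lra.
by rewrite ltr_norml; apply/andP; split; lra.
Qed.

Lemma local_inverse_decr f lo hi x e : lo < x < hi -> continuous f ->
  (forall u v, lo <= u -> u < v -> v <= hi -> f v < f u) -> 0 < e ->
  exists2 d, 0 < d & forall c, `|c - f x| < d ->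
    exists x', [/\ lo < x' < hi, `|x' - x| < e & f x' = c].
Proof.
move=> lxh fc fi e0.
have [||d d0 H] := @local_inverse_incr (fun u => - f u) lo hi x e lxh _ _ e0.
- by move=> u; apply: cvgN; exact: fc.
- by move=> u v *; rewrite ltrN2 fi.
exists d => // c cd; have [|x' [h1 h2 h3]] := H (- c).
  by rewrite -opprD normrN.
by exists x'; split => //; exact: oppr_inj.
Qed.

Lemma continuous_eps f x e : {for x, continuous f} -> 0 < e ->
  exists2 d, 0 < d & forall u, `|u - x| < d -> `|f u - f x| < e.
Proof.
move=> /cvgrPdist_lt fc e0; have /nbhs_ballP[d /= d0 H] := fc e e0.
by exists d => // u ud; rewrite distrC; apply: H; rewrite /ball /= distrC.
Qed.

End LocalInverse.

Section Nearby.
Variables (R : realType) (a th ps : R).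
Hypothesis a_gt0 : 0 < a.
Hypothesis thps : crossing_pair a th ps.
Implicit Types (z : R -> R) (s t x e c v : R).
Notation wp := (freq_pos R).
Notation wm := (freq_neg R).
Notation Gp := (G a wp).
Notation Gm := (G a wm).

Definition near_pair e t p := [/\ crossing_pair a t p, `|t - th| < e & `|p - ps| < e].

Let Gpc : continuous Gp. Proof. by move=> x; exact: Gp_cont. Qed.
Let Gmc : continuous Gm. Proof. by move=> x; exact: Gm_cont. Qed.

(** Depending on the phase at the starting time, the known level is Gp t, the common Gm t = Gm p, or
    Gp p. This lemma and the next two recover the pair from each; the other crossing follows from
    equality of Gm. *)
Lemma near_pair_down e : 0 < e -> exists2 d, 0 < d & forall c, `|c - Gp th| < d ->
  exists t p, near_pair e t p /\ Gp t = c.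
Proof.
move=> e0; have [t01 p01 E] := thps.
have [|d1 d10 H1] := @local_inverse_decr R Gm (10/3) 4 ps e p01 Gmc _ e0.
  by move=> u v *; apply: Gm_decr => //; lra.
have [d2 d20 H2] := continuous_eps (@Gm_cont R a th) d10.
pose e' := Num.min e d2.
have e'0 : 0 < e' by rewrite lt_min e0.
have [|d d0 H] := @local_inverse_incr R Gp 0 (2/3) th e' t01 Gpc _ e'0.
  by move=> u v *; apply: Gp_incr.
exists d => // c /H[t [t1 + t3]]; rewrite lt_min => /andP[te td].
have [|p [p1 p2 p3]] := H1 (Gm t); first by rewrite -E; exact: H2.
by exists t, p; split.
Qed.

Lemma near_pair_mid e : 0 < e -> exists2 d, 0 < d & forall c, `|c - Gm th| < d ->
  exists t p, [/\ near_pair e t p, Gm t = c & Gm p = c].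
Proof.
move=> e0; have [t01 p01 E] := thps.
have [|d1 d10 H1] := @local_inverse_decr R Gm (10/3) 4 ps e p01 Gmc _ e0.
  by move=> u v *; apply: Gm_decr => //; lra.
have [|d d0 H] := @local_inverse_incr R Gm 0 (2/3) th e t01 Gmc _ e0.
  by move=> u v *; apply: Gm_incr => //; lra.
exists (Num.min d1 d); first by rewrite lt_min d10.
move=> c; rewrite lt_min => /andP[c1 /H[t [t1 t2 t3]]].
have [|p [p1 p2 p3]] := H1 c; first by rewrite -E.
by exists t, p; split => //; split => //; split => //; rewrite t3.
Qed.

Lemma near_pair_up e : 0 < e -> exists2 d, 0 < d & forall c, `|c - Gp ps| < d ->
  exists t p, near_pair e t p /\ Gp p = c.
Proof.
move=> e0; have [t01 p01 E] := thps.
have [|d1 d10 H1] := @local_inverse_incr R Gm 0 (2/3) th e t01 Gmc _ e0.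
  by move=> u v *; apply: Gm_incr => //; lra.
have [d2 d20 H2] := continuous_eps (@Gm_cont R a ps) d10.
pose e' := Num.min e d2.
have e'0 : 0 < e' by rewrite lt_min e0.
have [|d d0 H] := @local_inverse_decr R Gp (10/3) 4 ps e' p01 Gpc _ e'0.
  by move=> u v *; apply: Gp_decr.
exists d => // c /H[p [p1 + p3]]; rewrite lt_min => /andP[pe pd].
have [|t [t1 t2 t3]] := H1 (Gm p); first by rewrite E; exact: H2.
by exists t, p; split.
Qed.

Let damp_bound s v (C D : R) :
  expR (a * s) * v + D - C = expR (a * s) * (v - expR (- (a * s)) * (C - D)).
Proof. by rewrite mulrBr mulrA -expRD addrN expR0 mul1r opprB addrA. Qed.

Let damp_small s v w (d : R) : 0 <= s <= 4 -> `|v - w| < d / expR (4 * a) ->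
  `|expR (a * s) * (v - w)| < d.
Proof.
have a0 := a_gt0; move=> /andP[s0 s4]; rewrite ltr_pdivlMr ?expR_gt0 // => H; apply: le_lt_trans H.
rewrite normrM mulrC ler_wpM2l // ger0_norm ?expR_ge0 // ler_expR; nra.
Qed.

(** A starting value close to the curve is converted into a level of the current phase, and that
    level into a nearby pair. *)
Lemma near_W s e : 0 <= s < 4 -> 0 < e -> exists2 d, 0 < d & forall v,
  `|v - crossing_curve a th ps s| < d -> exists t p, near_pair e t p /\ v = crossing_curve a t p s.
Proof.
move=> /andP[s0 s4] e0; have [/andP[t0 t1] /andP[p1 p2] E] := thps.
have s04 : 0 <= s <= 4 by rewrite s0 ltW.
have E4 : 0 < expR (4 * a) by exact: expR_gt0.
have Es : 0 < expR (a * s) by exact: expR_gt0.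
(* Unless s is itself a crossing time, keep the new crossing on its side of s. *)
have [e1 [e10 e1e e1t e1p]] : exists e1, [/\ 0 < e1, e1 <= e,
    s != th -> e1 <= `|s - th| & s != ps -> e1 <= `|s - ps|].
  pose m x := if s == x then e else Num.min e `|s - x|.
  have m0 x : 0 < m x.
    by rewrite /m; case: eqP => // /eqP sx; rewrite lt_min e0 normr_gt0 subr_eq0.
  exists (Num.min (m th) (m ps)); split.
  - by rewrite lt_min !m0.
  - by rewrite ge_min /m; case: eqP => // _; rewrite ?lexx // ge_min lexx.
  - by move=> /negbTE h; rewrite ge_min /m h ge_min lexx orbT.
  - by move=> /negbTE h; rewrite ge_min; apply/orP; right; rewrite /m h ge_min lexx orbT.
(* When s is itself a crossing time, the sign of v decides its phase. The side conditions here, in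
   [down] and in [mid] split the cases to fit the non-strict tests in [crossing_curve]. *)
have up : exists2 d, 0 < d & forall v, `|v - crossing_curve a th ps s| < d ->
    ps <= s -> (s = ps -> 0 < v) -> exists t p, near_pair e t p /\ v = crossing_curve a t p s.
  have [d d0 H] := near_pair_up e10.
  exists (d / expR (4 * a)); first by rewrite divr_gt0.
  move=> v /(damp_small s04) vd pss vpos.
  have WE : crossing_curve a th ps s = expR (- (a * s)) * (Gp ps - Gp s).
    rewrite /crossing_curve ifF; last by apply/negbTE; rewrite -ltNge; lra.
    by case: ifP => // h; have -> : s = ps; [apply/eqP; rewrite eq_le h|rewrite E !subrr].
  rewrite WE -damp_bound // in vd.
  have [t [p [[[tt pp tpE] ht hp] Gpp]]] := H _ vd.
  have ps' : p < s.
    move: pss; rewrite le_eqVlt => /predU1P[E'|pss].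
      have v0 := vpos (esym E'); rewrite ltNge; apply/negP => h.
      have : Gp p <= Gp s by apply: Gp_decrW => //; [lra|case/andP: pp => _ /ltW].
      by rewrite Gpp; nra.
    have : e1 <= `|s - ps| by apply: e1p; rewrite gt_eqF.
    by rewrite gtr0_norm ?subr_gt0 //; move: hp; rewrite ltr_norml => /andP[_ ?]; lra.
  exists t, p; split; first by split => //; exact: lt_le_trans e1e.
  move: tt pp => /andP[? ?] /andP[? ?].
  rewrite /crossing_curve ifF; last by apply/negbTE; rewrite -ltNge; lra.
  by rewrite ifF; [exact: eq_damped|apply/negbTE; rewrite -ltNge].
have down : exists2 d, 0 < d & forall v, `|v - crossing_curve a th ps s| < d ->
    s <= th -> (s = th -> 0 <= v) -> exists t p, near_pair e t p /\ v = crossing_curve a t p s.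
  have [d d0 H] := near_pair_down e10.
  exists (d / expR (4 * a)); first by rewrite divr_gt0.
  move=> v /(damp_small s04) vd sth vpos.
  have WE : crossing_curve a th ps s = expR (- (a * s)) * (Gp th - Gp s) by rewrite /crossing_curve sth.
  rewrite WE -damp_bound // in vd.
  have [t [p [[[tt pp tpE] ht hp] Gpt]]] := H _ vd.
  have st' : s <= t.
    move: sth; rewrite le_eqVlt => /predU1P[E'|sth].
      have v0 := vpos E'; rewrite leNgt; apply/negP => h.
      have : Gp t < Gp s by apply: Gp_incr => //; [case/andP: tt => /ltW|rewrite E'; exact: ltW].
      by rewrite Gpt; nra.
    have : e1 <= `|s - th| by apply: e1t; rewrite lt_eqF.
    by rewrite ltr0_norm ?subr_lt0 //; move: ht; rewrite ltr_norml => /andP[? _]; lra.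
  exists t, p; split; first by split => //; exact: lt_le_trans e1e.
  by rewrite /crossing_curve st'; exact: eq_damped.
have mid : exists2 d, 0 < d & forall v, `|v - crossing_curve a th ps s| < d ->
    th <= s <= ps -> (s = th -> v < 0) -> (s = ps -> v <= 0) ->
    exists t p, near_pair e t p /\ v = crossing_curve a t p s.
  have [d d0 H] := near_pair_mid e10.
  exists (d / expR (4 * a)); first by rewrite divr_gt0.
  move=> v /(damp_small s04) vd /andP[ths sps] vt vp.
  have WE : crossing_curve a th ps s = expR (- (a * s)) * (Gm th - Gm s).
    rewrite /crossing_curve sps; case: ifP => // h.
    by have -> : s = th; [apply/eqP; rewrite eq_le h|rewrite !subrr].
  rewrite WE -damp_bound // in vd.
  have [t [p [[[tt pp tpE] ht hp] Gmt Gmp']]] := H _ vd.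
  have ts : t < s.
    move: ths; rewrite le_eqVlt => /predU1P[E'|ths].
      have v0 := vt (esym E'); rewrite ltNge; apply/negP => h.
      have : Gm s <= Gm t.
        move: h; rewrite le_eqVlt => /predU1P[->//|h].
        by apply: ltW; apply: Gm_incr => //; case/andP: tt => _ ?; lra.
      by rewrite Gmt; nra.
    have : e1 <= `|s - th| by apply: e1t; rewrite gt_eqF.
    by rewrite gtr0_norm ?subr_gt0 //; move: ht; rewrite ltr_norml => /andP[_ ?]; lra.
  have sp : s <= p.
    move: sps; rewrite le_eqVlt => /predU1P[E'|sps].
      have v0 := vp E'; rewrite leNgt; apply/negP => h.
      have : Gm s < Gm p by apply: Gm_decr => //; [case/andP: pp => ? _; lra|exact: ltW].
      by rewrite Gmp'; nra.
    have : e1 <= `|s - ps| by apply: e1p; rewrite lt_eqF.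
    by rewrite ltr0_norm ?subr_lt0 //; move: hp; rewrite ltr_norml => /andP[? _]; lra.
  exists t, p; split; first by split => //; exact: lt_le_trans e1e.
  by rewrite /crossing_curve leNgt ts /= sp; exact: eq_damped.
have [d1 d10 H1] := up; have [d2 d20 H2] := down; have [d3 d30 H3] := mid.
clear up down mid e1t e1p e1e e10 E4 Es.
exists (Num.min d1 (Num.min d2 d3)); first by rewrite !lt_min d10 d20.
move=> v; rewrite !lt_min => /and3P[v1 v2 v3].
have [sth|ths] := leP s th.
  have [E'|sth'] := eqVneq s th; last by apply: H2 => // h; rewrite h eqxx in sth'.
  have [v0|v0] := leP 0 v; first by apply: H2.
  by apply: H3 => // [|h]; [apply/andP; split; lra|lra].
have [pss|sps] := ltP ps s.
  by apply: H1 => //; [exact: ltW|move=> h; rewrite h ltxx in pss].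
have [E'|sps'] := eqVneq s ps.
  have [v0|v0] := ltP 0 v; first by apply: H1 => //; rewrite E'.
  by apply: H3 => //; [rewrite ltW //|move=> h; lra].
apply: H3 => //; [by rewrite ltW|by move=> h; lra|by move=> h; rewrite h eqxx in sps'].
Qed.

End Nearby.

(** * Stability *)

Section Closeness.
Variable R : realType.
Implicit Types (x t u d e A B : R).

(** For piecewise functions with different breakpoints, the mixed comparisons occur only between
    these breakpoints. *)
Lemma if_close x t u A B A' B' e : `|A - A'| < e -> `|B - B'| < e ->
  (t <= x <= u -> `|B - A'| < e) -> (u <= x <= t -> `|A - B'| < e) ->
  `|(if x <= t then A else B) - (if x <= u then A' else B')| < e.
Proof.
move=> aa bb ba ab; have [xt|/ltW tx] := leP x t; have [xu|/ltW ux] := leP x u => //.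
  by apply: ab; rewrite ux.
by apply: ba; rewrite tx.
Qed.

Lemma norm_sub_lt A B e : `|A| < e / 2 -> `|B| < e / 2 -> `|A - B| < e.
Proof. by move=> A2 B2; rewrite (le_lt_trans (ler_normB _ _)) // [e]splitr ltrD. Qed.

Lemma between_norm t x u d : t <= x <= u -> `|t - u| < d -> `|t - x| < d /\ `|u - x| < d.
Proof.
move=> /andP[tx xu]; rewrite !ltr_norml => /andP[d1 d2].
by split; apply/andP; split; lra.
Qed.

End Closeness.

Section Stability.
Variables (R : realType) (a th ps : R).
Hypothesis a_gt0 : 0 < a.
Hypothesis thps : crossing_pair a th ps.
Implicit Types (z : R -> R) (s t x e c v : R).
Notation wp := (freq_pos R).
Notation wm := (freq_neg R).
Notation Gp := (G a wp).
Notation Gm := (G a wm).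
Notation near_pair := (near_pair a th ps).

Lemma G_lipschitz w x t : a ^+ 2 + w ^+ 2 != 0 -> 0 <= x <= 4 -> 0 <= t <= 4 ->
  `|G a w x - G a w t| <= expR (4 * a) * `|x - t|.
Proof.
have a0 := a_gt0; move=> D0; wlog xt : x t / x <= t.
  move=> H x4 t4; have [xt|/ltW tx] := leP x t; first exact: H.
  by rewrite distrC [`|x - t|]distrC H.
move=> /andP[x0 _] /andP[_ t4]; rewrite distrC [`|x - t|]distrC.
move: xt; rewrite le_eqVlt => /predU1P[->|xt]; first by rewrite !subrr normr0 mulr0.
have [c /andP[xc ct] ->] := MVT_global xt (fun x => is_derive_G x D0).
rewrite normrM ler_wpM2r // normrM -[leRHS]mulr1 ler_pM ?sin_max //.
by rewrite ger0_norm ?expR_ge0 // ler_expR; nra.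
Qed.

Lemma W_close e : 0 < e -> exists2 d, 0 < d & forall t p x, near_pair d t p ->
  0 <= x <= 4 -> `|crossing_curve a t p x - crossing_curve a th ps x| < e.
Proof.
move=> e0; have E4 : 0 < expR (4 * a) by exact: expR_gt0.
exists (e / (2 * expR (4 * a))); first by rewrite divr_gt0 ?mulr_gt0.
set d := e / _ => t p x [[/andP[t0 t1] /andP[p1 p2] tp] ht hp] x04.
have [/andP[th0 th1] /andP[ps1 ps2] E] := thps.
have lip w u v : 0 < w -> 0 <= u <= 4 -> 0 <= v <= 4 -> `|u - v| < d ->
    `|G a w u - G a w v| < e / 2.
  move=> w0 u4 v4 uv; have D0 : a ^+ 2 + w ^+ 2 != 0.
    by rewrite gt_eqF // ltr_wpDl ?sqr_ge0 ?exprn_gt0.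
  apply: le_lt_trans (G_lipschitz D0 u4 v4) _.
  move: uv; rewrite /d !ltr_pdivlMr ?mulr_gt0 // => uv.
  by rewrite (_ : _ * 2 = `|u - v| * (2 * expR (4 * a))) //; ring.
have {}lip w u v : 0 < w -> 0 <= u <= 4 -> 0 <= v <= 4 -> `|u - v| < d ->
    `|G a w u - G a w v| < e /\ `|G a w u - G a w v| < e / 2.
  move=> w0 u4 v4 uv; have := lip w u v w0 u4 v4 uv => L; split => //.
  by apply: lt_trans L _; lra.
have t4 : 0 <= t <= 4 by lra.
have th4 : 0 <= th <= 4 by lra.
have p4 : 0 <= p <= 4 by lra.
have ps4 : 0 <= ps <= 4 by lra.
have wp0 := wp_gt0 R; have wm0 := wm_gt0 R.
have cancel (A B C : R) : A - C - (B - C) = A - B by ring.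
(* Between the old and the new crossing time the curves are in different phases, but s is then close
   to both times, so each bracket is below e/2 by itself. *)
have swap w w' u v (s : R) : 0 < w -> 0 < w' -> 0 <= u <= 4 -> 0 <= v <= 4 ->
    0 <= s <= 4 -> `|u - s| < d -> `|v - s| < d ->
    `|G a w u - G a w s - (G a w' v - G a w' s)| < e.
  move=> w0 w'0 u4 v4 s4 us vs.
  by apply: norm_sub_lt; [case: (lip w u s)|case: (lip w' v s)].
rewrite /crossing_curve -mulrBr normrM.
have le1 : `|expR (- (a * x))| <= 1.
  have a0 := a_gt0; have /andP[x0 _] := x04.
  by rewrite ger0_norm ?expR_ge0 // expR_le1 oppr_le0 mulr_ge0 // ltW.
apply: (@le_lt_trans _ _ (1 * _)); first by apply: ler_wpM2r; [|exact: le1].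
rewrite mul1r; apply: if_close.
- by rewrite cancel; case: (lip wp t th).
- apply: if_close.
  + by rewrite cancel; case: (lip wm t th).
  + by rewrite cancel; case: (lip wp p ps).
  + move=> pxps; have [h1 h2] := between_norm pxps hp.
    by rewrite E; exact: swap.
  + rewrite distrC in hp; move=> psxp; have [h1 h2] := between_norm psxp hp.
    by rewrite tp; exact: swap.
- move=> txth; have [h1 h2] := between_norm txth ht.
  rewrite ifT; last by have /andP[_ h] := txth; lra.
  exact: swap.
- rewrite distrC in ht; move=> thxt; have [h1 h2] := between_norm thxt ht.
  rewrite [X in _ - X]ifT; last by have /andP[_ h] := thxt; lra.
  exact: swap.
Qed.

Lemma stays_close s e : 0 <= s < 4 -> 0 < e -> exists2 d, 0 < d & forall z,
  obeys_flow a s z -> `|z s - crossing_curve a th ps s| < d ->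
  forall x, s <= x <= 4 -> `|z x - crossing_curve a th ps x| < e.
Proof.
move=> s04 e0; have [e' e'0 H1] := W_close e0; have [d d0 H2] := near_W a_gt0 thps s04 e'0.
exists d => // z fl /H2[t [p [tp zs]]] x sx4; have [tp1 _ _] := tp.
rewrite (trajectory s04 tp1 fl zs sx4); apply: H1 => //.
by case/andP: s04 => s0 _; case/andP: sx4 => sx ->; rewrite (le_trans s0).
Qed.

(* In the coordinate Gp th, the return map contracts by exp(-4a) as long as
   m separates the down-crossings from the mirror images 4 - ps of the
   up-crossings: Gp - rho(m) Gm is increasing both left of m and on
   [10/3, 4 - m], where rho = sin (wp x) / sin (wm x) = 1 + 2 cos (pi x). *)
Lemma return_contracts m t1 p1 t2 p2 : 0 <= m <= 2/3 ->
  crossing_pair a t1 p1 -> crossing_pair a t2 p2 -> t2 <= m -> p1 <= 4 - m ->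
  t1 <= t2 -> p2 <= p1 /\ 0 <= Gp p2 - Gp p1 <= Gp t2 - Gp t1.
Proof.
move=> /andP[m0 m1] [/andP[a1 a2] /andP[b1 b2] E1] [/andP[a3 a4] /andP[b3 b4] E2] tm pm tt.
have p21 : p2 <= p1.
  rewrite leNgt; apply/negP => h; have : Gm p2 < Gm p1 by apply: Gm_decr; lra.
  move: tt; rewrite -E1 -E2 le_eqVlt => /predU1P[->|tt]; first by rewrite ltxx.
  have : Gm t1 < Gm t2 by apply: Gm_incr; lra.
  lra.
split => //; set rho := 1 + 2 * cos (pi * m).
pose f x := Gp x - rho * Gm x.
have fd x : is_derive x 1 f
    (expR (a * x) * sin (wm * x) * (2 * (cos (pi * x) - cos (pi * m)))).
  have ? := @is_derive_Gp R a x; have ? := @is_derive_Gm R a x.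
  rewrite /f; apply: is_derive_eq; rewrite /GRing.scale /= sin_wp /rho; ring.
have low : f t1 <= f t2.
  apply: (le_of_derive_ge0 tt fd) => x /andP[x1 x2].
  rewrite !mulr_ge0 ?expR_ge0 ?subr_ge0 //; first by apply: ltW; apply: sin_wm_gt0; lra.
  by apply: cos_pi_anti; lra.
have high : f p2 <= f p1.
  apply: (le_of_derive_ge0 p21 fd) => x /andP[x1 x2].
  rewrite mulr_le0 //.
    by rewrite pmulr_rle0 ?expR_gt0 //; apply: ltW; apply: sin_wm_lt0; lra.
  rewrite pmulr_rle0 // subr_le0.
  have -> : cos (pi * x) = cos (pi * (4 - x)).
    rewrite -cosN (_ : pi * (4 - x) = - (pi * x) + pi *+ 2 + pi *+ 2); last by ring.
    by rewrite !cosD2pi.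
  by apply: cos_pi_anti; lra.
(* Since Gm takes equal values on each pair, both inequalities chain through rho (Gm p2 - Gm p1). *)
move: low high; rewrite /f E1 E2 => low high; apply/andP; split.
  by rewrite subr_ge0; apply: Gp_decrW; lra.
by lra.
Qed.

Hypothesis periodic : Gp ps = Gp (th + 4).

Lemma W_periodic : crossing_curve a th ps 4 = crossing_curve a th ps 0.
Proof.
have [/andP[t0 t1] /andP[p1 p2] E] := thps.
rewrite /crossing_curve (ltW t0) !ifF; try by apply/negbTE; rewrite -ltNge; lra.
have G4 : Gp 4 = expR (4 * a) * Gp 0 by rewrite -Gp4 add0r.
by rewrite periodic Gp4 G4 -mulrBr mulrA [a * 4]mulrC -expRD addNr mulr0 oppr0 expR0.
Qed.

Lemma one_period_contraction : exists2 r, 0 < r & forall z, obeys_flow a 0 z ->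
  `|z 0 - crossing_curve a th ps 0| < r ->
  `|z 4 - crossing_curve a th ps 4| <= expR (- (4 * a)) * `|z 0 - crossing_curve a th ps 0|.
Proof.
have [/andP[t0 t1] /andP[p1 p2] E] := thps.
have thps4 : th + ps < 4 by apply: (crossing_order a_gt0 _ _ periodic); rewrite ?t0 ?p1.
(* With m the midpoint of th and 4 - ps, every pair within half their distance still has its
   crossings on the required sides of m. *)
pose m := (th + (4 - ps)) / 2.
have e0 : 0 < (4 - ps - th) / 2 by lra.
have s04 : 0 <= (0 : R) < 4 by rewrite lexx /=.
have [r r0 H] := near_W a_gt0 thps s04 e0; exists r => // z fl /H[t [p [[tp ht hp] z0]]].
have z4 : z 4 = crossing_curve a t p 4 by apply: (trajectory s04 tp fl z0); rewrite lexx andbT.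
have [/andP[t0' t1'] /andP[p1' p2'] E'] := tp.
have W0 u q : 0 < u -> crossing_curve a u q 0 = Gp u - Gp 0.
  by move=> /ltW u0; rewrite /crossing_curve u0 mulr0 oppr0 expR0 mul1r.
have W4 u q : u < 2/3 -> q < 4 -> crossing_curve a u q 4 = expR (- (4 * a)) * (Gp q - Gp 4).
  move=> u1 q4; rewrite /crossing_curve [a * 4]mulrC !ifF //; apply/negbTE; rewrite -ltNge //; lra.
(* At time 0 the deviation is exactly a difference of levels Gp, at time 4 it is one times exp(-4a),
   so no constant is lost. *)
rewrite z4 z0 !W0 // !W4 // -mulrBr normrM ger0_norm ?expR_ge0 // ler_pM2l ?expR_gt0 //.
rewrite !opprB !addrA !subrK.
move: ht hp; rewrite !ltr_norml => /andP[? ?] /andP[? ?].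
have m01 : 0 <= m <= 2/3 by rewrite /m; apply/andP; split; lra.
have [tth|tht] := leP t th.
  have [||_ /andP[h1 h2]] := @return_contracts m t p th ps m01 tp thps _ _ tth; try by rewrite /m; lra.
  rewrite distrC ger0_norm // distrC ger0_norm //; exact: le_trans h2.
have [||_ /andP[h1 h2]] := @return_contracts m th ps t p m01 thps tp _ _ (ltW tht); try by rewrite /m; lra.
rewrite ger0_norm // ger0_norm //; exact: le_trans h2.
Qed.

End Stability.

(** * The periodic orbit *)

Section Pieces.
Variable R : realType.
Notation mu := (@lebesgue_measure R).
Implicit Types (y g p : R -> R) (s t m C w a : R).

(** The slope of the orbit follows a smooth formula only strictly between crossings; the endpoints
    form a null set. *)
Lemma integral_open_agree s t g p : s < t -> continuous p ->
  (forall x, s < x < t -> g x = p x) ->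
  mu.-integrable `[s, t] (EFin \o g) /\ \int[mu]_(x in `[s, t]) g x = \int[mu]_(x in `[s, t]) p x.
Proof.
move=> st pc gp.
have ip : mu.-integrable `[s, t] (EFin \o p).
  by apply: continuous_compact_integrable; [exact: segment_compact|exact: continuous_subspaceT].
have ipo : mu.-integrable `]s, t[ (EFin \o p).
  by apply: integrableS ip => //; exact: subset_itv_oo_cc.
have igo : mu.-integrable `]s, t[ (EFin \o g).
  by apply: eq_integrable ipo => // x; rewrite inE /= in_itv /= => h; rewrite gp.
have mgo := measurable_int mu igo; have mpo := measurable_int mu ipo.
split.
  apply/integrableP; split; first exact: measurable_realfun.emeasurable_fun_itv_cc mgo.
  rewrite integral_itv_bndoo; last by apply: measurableT_comp => //; exact: mgo.
  by case/integrableP : igo.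
rewrite /Rintegral integral_itv_bndoo; last exact: mgo.
rewrite [in RHS]integral_itv_bndoo; last exact: mpo.
congr fine; apply: eq_integral => x; rewrite inE /= in_itv /= => h.
by rewrite gp.
Qed.

Lemma integral_of_piece a w s t y g C : a ^+ 2 + w ^+ 2 != 0 -> s < t ->
  (forall x, s <= x <= t -> y x = expR (- (a * x)) * (C - G a w x)) ->
  (forall x, s < x < t -> g x = - a * y x - sin (w * x)) -> integral_of s t y g.
Proof.
move=> D0 st yE gE.
pose P x := expR (- (a * x)) * (C - G a w x).
pose p (x : R) : R := - a * P x - sin (w * x).
have Pd (x : R) : is_derive x 1 P (p x).
  have Gd := is_derive_G x D0.
  have -> : p x = - a * P x - expR (- (a * x)) * (expR (a * x) * sin (w * x)).
    by rewrite /p mulrA -expRD addNr expR0 mul1r.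
  by rewrite /P; apply: is_derive_eq; rewrite /GRing.scale /=; ring.
have pc : continuous p.
  move=> x; apply: cvgB; last exact: continuous_sinM.
  by apply: cvgM; [exact: cvg_cst|exact: is_derive_continuous (Pd x)].
have gp x : s < x < t -> g x = p x.
  by move=> sxt; rewrite gE // yE //; case/andP: sxt => /ltW -> /ltW.
have [ig _] := integral_open_agree st pc gp.
move=> x u sx xu ut; split.
  apply: integrableS ig => // v /=; rewrite !in_itv /= => /andP[xv vu].
  by rewrite (le_trans sx xv) (le_trans vu ut).
move: (xu); rewrite le_eqVlt => /predU1P[<-|xltu].
  by rewrite subrr set_itv1 Rintegral_set1.
have gp' v : x < v < u -> g v = p v.
  by move=> /andP[xv vu]; apply: gp; rewrite (le_lt_trans sx xv) (lt_le_trans vu ut).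
have [_ ->] := integral_open_agree xltu pc gp'.
rewrite (yE x) ?sx ?(le_trans xu) // (yE u) ?ut ?(le_trans sx) //.
rewrite /Rintegral (@continuous_FTC2 _ p P x u xltu) //.
- exact: continuous_subspaceT.
- split; first by move=> v _; exact: ex_derive.
  + by apply: cvg_at_right_filter; exact: is_derive_continuous (Pd x).
  + by apply: cvg_at_left_filter; exact: is_derive_continuous (Pd u).
- by move=> v _; rewrite derive1E derive_val.
Qed.

Lemma integral_of_glue s m t y g : s <= m -> m <= t ->
  integral_of s m y g -> integral_of m t y g -> integral_of s t y g.
Proof.
move=> sm mt H1 H2 x u sx xu ut.
have [um|mu'] := leP u m; first exact: H1.
have [mx|xm] := leP m x; first exact: H2.
have [i1 e1] := H1 x m sx (ltW xm) (lexx m).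
have [i2 e2] := H2 m u (lexx m) (ltW mu') ut.
have i3 : mu.-integrable `]m, u] (EFin \o g).
  by apply: integrableS i2 => //; apply: subset_itvr; rewrite bnd_simp.
have xmu : `[x, u]%classic = `[x, m] `|` `]m, u].
  by rewrite (@itv_bndbnd_setU _ _ _ (BRight m)) // bnd_simp // ltW.
have dis : [disjoint `[x, m] & `]m, u]].
  apply/disj_setPS => v [/=]; rewrite !in_itv /= => /andP[_ vm] /andP[mv _].
  by move: mv; rewrite ltNge vm.
have m1 := measurable_int mu i1; have m3 := measurable_int mu i3.
have ixu : mu.-integrable `[x, u] (EFin \o g).
  rewrite xmu; apply/integrableP; split.
    by apply/measurable_funU => //.
  rewrite ge0_integral_setU //.
  - by apply: lte_add_pinfty; [case/integrableP: i1|case/integrableP: i3].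
  - by apply/measurable_funU => //; split; apply: measurableT_comp.
split => //.
rewrite -(subrK (y m) (y u)) -addrA addrC e1 e2 xmu Rintegral_setU -?xmu //.
by rewrite Rintegral_itv_obnd_cbnd.
Qed.

End Pieces.

Section PeriodicOrbit.
Variables (R : realType) (a th ps : R).
Hypothesis a_gt0 : 0 < a.
Hypothesis thps : crossing_pair a th ps.
Implicit Types (x s t u : R) (k n : nat).
Notation wp := (freq_pos R).
Notation wm := (freq_neg R).
Notation Gp := (G a wp).
Notation Gm := (G a wm).
Hypothesis periodic : Gp ps = Gp (th + 4).
Notation W := (crossing_curve a th ps).

Lemma W_gt0_left x : 0 <= x < th -> 0 < W x.
Proof.
move=> /andP[x0 xt]; have [/andP[t0 t1] _ _] := thps.
by rewrite /crossing_curve (ltW xt) mulr_gt0 ?expR_gt0 // subr_gt0 Gp_incr // ltW.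
Qed.

Lemma W_lt0 x : th < x < ps -> W x < 0.
Proof.
move=> /andP[tx xp]; have [/andP[t0 t1] /andP[p1 p2] E] := thps.
rewrite /crossing_curve leNgt tx /= (ltW xp) pmulr_rlt0 ?expR_gt0 // subr_lt0.
have [x2|x2] := leP x 2; first by apply: Gm_incr => //; exact: ltW.
by rewrite E; apply: Gm_decr => //; exact: ltW.
Qed.

Lemma W_gt0_right x : ps < x <= 4 -> 0 < W x.
Proof.
move=> /andP[px x4]; have [/andP[t0 t1] /andP[p1 p2] E] := thps.
rewrite /crossing_curve ifF; last by apply/negbTE; rewrite -ltNge; lra.
rewrite leNgt px /= mulr_gt0 ?expR_gt0 // subr_gt0 Gp_decr //; exact: ltW.
Qed.

Lemma W_eq0 x : 0 <= x <= 4 -> W x = 0 -> x = th \/ x = ps.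
Proof.
move=> /andP[x0 x4] Wx.
have [xt|tx|] := ltgtP x th; last by left.
  by have := @W_gt0_left x; rewrite x0 xt Wx ltxx => /(_ isT).
have [xp|px|] := ltgtP x ps; last by right.
  by have := @W_lt0 x; rewrite tx xp Wx ltxx => /(_ isT).
by have := @W_gt0_right x; rewrite px x4 Wx ltxx => /(_ isT).
Qed.

Definition orbit x : R := W (x - 4 * (Num.truncn (x / 4))%:R).

(** Valid on closed blocks because W takes equal values at 0 and 4; adjacent blocks thus share an
    endpoint and can be glued. *)
Lemma orbitE k x : 4 * k%:R <= x <= 4 * k%:R + 4 -> orbit x = W (x - 4 * k%:R).
Proof.
move=> /andP[kx]; rewrite le_eqVlt => /predU1P[E|xk].
  have -> : orbit x = W 0.
    rewrite /orbit (_ : x / 4 = k.+1%:R); last by rewrite E -[k.+1%:R]natr1; field.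
    by rewrite natrK (_ : x - _ = 0) // E -[k.+1%:R]natr1; ring.
  by rewrite -(W_periodic thps periodic) E addrAC subrr add0r.
have k0 := ler0n R k.
rewrite /orbit (_ : Num.truncn (x / 4) = k) //; apply/eqP.
have x0 : 0 <= x / 4 by lra.
by rewrite truncn_eq // -[k.+1%:R]natr1; apply/andP; split; lra.
Qed.

Lemma block_of x : 0 <= x -> exists k, 4 * k%:R <= x < 4 * k%:R + 4.
Proof.
move=> x0; exists (Num.truncn (x / 4)).
have /truncn_itv : 0 <= x / 4 by rewrite divr_ge0.
set k := Num.truncn _; rewrite -[k.+1%:R]natr1 => /andP[? ?]; apply/andP; split; lra.
Qed.

Lemma orbit_periodic : four_periodic orbit.
Proof.
move=> x x0; have [k /andP[k1 k2]] := block_of x0.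
rewrite (@orbitE k x) ?k1 ?(ltW k2) // (@orbitE k.+1 (x + 4)).
  by rewrite -[k.+1%:R]natr1; congr W; ring.
by rewrite -[k.+1%:R]natr1; apply/andP; split; lra.
Qed.

(** The zeros are isolated: a stretch of zeros starting at x1 would contain a point strictly before
    the next crossing or the end of the period. *)
Lemma orbit_non_sliding : non_sliding 0 orbit.
Proof.
move=> [x1 [x2 [x10 [x12 zero]]]]; have [k /andP[k1 k2]] := block_of x10.
have [/andP[t0 t1] /andP[p1 p2] E] := thps.
set c := 4 * k%:R in k1 k2.
have near x : x1 <= x <= x2 -> x <= c + 4 -> x - c = th \/ x - c = ps.
  move=> x12' xc; apply: W_eq0; first by have /andP[? _] := x12'; apply/andP; split; lra.
  by rewrite -orbitE ?zero // -/c xc andbT; case/andP: x12' => h _; exact: le_trans h.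
have gap nxt : x1 < nxt -> nxt <= c + 4 ->
    (forall x, x1 < x < nxt -> x - c <> th /\ x - c <> ps) -> False.
  move=> n1 n4 H; pose x := Num.min x2 ((x1 + nxt) / 2).
  have xl : x <= x2 by rewrite ge_min lexx.
  have xr : x <= (x1 + nxt) / 2 by rewrite ge_min lexx orbT.
  have xx : x1 < x by rewrite lt_min x12 /=; lra.
  have [] := H x; first by apply/andP; split; lra.
  have [||->|->] := near x; [by rewrite xl ltW|lra|by []|by []].
have [||e|e] := near x1; [by rewrite lexx ltW|lra| |].
  by apply: (gap (c + ps)); [lra|lra|move=> x /andP[? ?]; split=> ?; lra].
by apply: (gap (c + 4)); [lra|lra|move=> x /andP[? ?]; split=> ?; lra].
Qed.

(** At the crossings themselves, lambda = 0 is one admissible choice. *)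
Definition orbit_slope x : R := if 0 < orbit x then rhs a 1 x (orbit x)
  else if orbit x < 0 then rhs a (-1) x (orbit x) else rhs a 0 x 0.

Lemma orbit_filippov x : filippov a x (orbit x) (orbit_slope x).
Proof.
rewrite /filippov /orbit_slope; have [h|h|h] := ltgtP 0 (orbit x).
- by left.
- by right; left.
- by right; right; split => //; exists 0; split => //; rewrite ltrN10 ltr01.
Qed.

Lemma orbit_block k : integral_of (4 * k%:R) (4 * k%:R + 4) orbit orbit_slope.
Proof.
have [/andP[t0 t1] /andP[p1 p2] E] := thps.
have w1 := wp_gt0 R; have w2 := wm_gt0 R.
set c := 4 * k%:R.
have nz w : 0 < w -> a ^+ 2 + w ^+ 2 != 0.
  by move=> w0; rewrite gt_eqF // ltr_wpDl ?sqr_ge0 ?exprn_gt0.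
have shift x : expR (- (a * (x - c))) = expR (c * a) * expR (- (a * x)).
  by rewrite -expRD; congr expR; ring.
have gp x : Gp x = expR (c * a) * Gp (x - c).
  rewrite -{1}(subrK c x); apply: G_shift_nat; [exact: sin_wp4|exact: cos_wp4].
have gm x : Gm x = expR (c * a) * Gm (x - c).
  rewrite -{1}(subrK c x); apply: G_shift_nat; [exact: sin_wm4|exact: cos_wm4].
have oE x : c <= x -> x <= c + 4 -> orbit x = W (x - c).
  by move=> *; apply: orbitE; apply/andP.
have slope_pos x : 0 < orbit x -> orbit_slope x = - a * orbit x - sin (wp * x).
  by move=> h; rewrite /orbit_slope h rhs_pos.
have slope_neg x : orbit x < 0 -> orbit_slope x = - a * orbit x - sin (wm * x).
  by move=> h; rewrite /orbit_slope h (lt_gtF h) rhs_neg.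
apply: (@integral_of_glue _ _ (c + th)); [lra|lra| |].
  apply: (@integral_of_piece _ a wp _ _ _ _ (expR (c * a) * Gp th)) => //; [exact: nz|lra| |].
    move=> x /andP[x1 x2]; rewrite oE //; last by lra.
    rewrite /crossing_curve ifT; last by lra.
    by rewrite shift (gp x); ring.
  move=> x /andP[x1 x2]; apply: slope_pos; rewrite oE ?(ltW x1) //; last by lra.
  by apply: W_gt0_left; lra.
apply: (@integral_of_glue _ _ (c + ps)); [lra|lra| |].
  apply: (@integral_of_piece _ a wm _ _ _ _ (expR (c * a) * Gm th)) => //; [exact: nz|lra| |].
    move=> x /andP[x1 x2]; rewrite oE //; [|lra|lra].
    rewrite /crossing_curve [X in _ * (if _ then _ else X)]ifT; last by lra.
    case: ifP => h; last by rewrite shift (gm x); ring.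
    have xt : x - c = th by apply/eqP; rewrite eq_le h; lra.
    by rewrite shift (gm x) xt; ring.
  move=> x /andP[x1 x2]; apply: slope_neg; rewrite oE //; [|lra|lra].
  by apply: W_lt0; lra.
apply: (@integral_of_piece _ a wp _ _ _ _ (expR (c * a) * Gp ps)) => //; [exact: nz|lra| |].
  move=> x /andP[x1 x2]; rewrite oE //; last by lra.
  rewrite /crossing_curve ifF; last by apply/negbTE; rewrite -ltNge; lra.
  case: ifP => h; last by rewrite shift (gp x); ring.
  have xt : x - c = ps by apply/eqP; rewrite eq_le h; lra.
  by rewrite shift (gp x) xt E; ring.
move=> x /andP[x1 x2]; apply: slope_pos; rewrite oE //; [|lra|lra].
by apply: W_gt0_right; lra.
Qed.

Lemma orbit_solution : is_solution a 0 orbit.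
Proof.
exists orbit_slope; split=> [x _|x x0]; first exact: orbit_filippov.
have all k : integral_of 0 (4 * k%:R + 4) orbit orbit_slope.
  elim: k => [|k IH]; first by have := @orbit_block 0%N; rewrite mulr0 add0r.
  have k0 := ler0n R k.
  have E : 4 * k.+1%:R = 4 * k%:R + 4 :> R by rewrite -[k.+1%:R]natr1; ring.
  by apply: (integral_of_glue _ _ IH); rewrite -?E; [lra|lra|exact: orbit_block].
have [k /andP[_ k2]] := block_of x0.
have [i e] := all k 0 x (lexx 0) x0 (ltW k2); split => //.
by rewrite -e addrC subrK.
Qed.

(* Beyond the first multiple of 4 the deviation at multiples of 4 decays
   geometrically, and within each period it is controlled by its initial value. *)
Lemma orbit_stable : loc_asympt_stable a orbit.
Proof.
move=> x0 x00; have [k /andP[k1 k2]] := block_of x00.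
set c := 4 * k%:R in k1 k2; pose q := expR (- (4 * a)).
have q0 : 0 <= q by exact: expR_ge0.
have q1 : q < 1 by rewrite expR_lt1 oppr_lt0 mulr_gt0.
have [r r0 contr] := one_period_contraction a_gt0 thps periodic.
have s04 : 0 <= x0 - c < 4 by apply/andP; split; lra.
have z04 : 0 <= (0 : R) < 4 by rewrite lexx /=.
have start e : 0 < e -> exists2 d, 0 < d & forall z, is_solution a x0 z ->
    `|z x0 - orbit x0| < d -> forall x, x0 <= x <= c + 4 -> `|z x - orbit x| < e.
  move=> e0; have [d d0 H] := stays_close a_gt0 thps s04 e0; exists d => // z zs zd x /andP[x1 x2].
  have fl : obeys_flow a (x0 - c) (fun x => z (x + c)).
    by apply: obeys_flow_shift; rewrite subrK; exact: is_solution_obeys_flow.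
  have := H _ fl; rewrite subrK -orbitE ?k1 ?(ltW k2) // => /(_ zd (x - c)).
  rewrite subrK -orbitE; last by rewrite -/c; apply/andP; split => //; lra.
  by apply; apply/andP; split; lra.
have period e : 0 < e -> exists2 d, 0 < d & forall z n, is_solution a x0 z ->
    `|z (4 * (k + n).+1%:R) - W 0| < d ->
    forall x, 4 * (k + n).+1%:R <= x <= 4 * (k + n).+1%:R + 4 -> `|z x - orbit x| < e.
  move=> e0; have [d d0 H] := stays_close a_gt0 thps z04 e0; exists d => // z n zs zd x xn.
  have fl : obeys_flow a 0 (fun x => z (x + 4 * (k + n).+1%:R)).
    apply: obeys_flow_shift; rewrite add0r; apply: obeys_flow_later (is_solution_obeys_flow a_gt0 zs).
    by rewrite -[(k + n).+1%:R]natr1 natrD; have := ler0n R n; move: k2; rewrite /c; lra.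
  have := H _ fl; rewrite add0r => /(_ zd (x - 4 * (k + n).+1%:R)).
  by rewrite subrK -orbitE //; apply; case/andP: xn => *; apply/andP; split; lra.
have decay z : is_solution a x0 z -> `|z (c + 4) - W 0| < r ->
    forall n, `|z (4 * (k + n).+1%:R) - W 0| <= q ^+ n * `|z (c + 4) - W 0|.
  move=> zs zr; elim=> [|n IH].
    by rewrite addn0 expr0 mul1r (_ : 4 * k.+1%:R = c + 4) // -[k.+1%:R]natr1 mulrDr mulr1.
  have fl : obeys_flow a 0 (fun x => z (x + 4 * (k + n).+1%:R)).
    apply: obeys_flow_shift; rewrite add0r; apply: obeys_flow_later (is_solution_obeys_flow a_gt0 zs).
    by rewrite -[(k + n).+1%:R]natr1 natrD; have := ler0n R n; move: k2; rewrite /c; lra.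
  (* As q^n <= 1, the deviation stays below r and the contraction can be applied again. *)
  have := contr _ fl; rewrite add0r (W_periodic thps periodic) => /(_ _)/wrap[|H].
    apply: le_lt_trans IH (le_lt_trans _ zr).
    by rewrite ler_piMl // exprn_ile1 // ltW.
  have -> : 4 * (k + n.+1).+1%:R = 4 + 4 * (k + n).+1%:R :> R.
    by rewrite addnS -[(k + n).+2%:R]natr1; ring.
  by rewrite exprS -mulrA; apply: le_trans H _; rewrite ler_wpM2l.
have orbit4 : orbit (c + 4) = W 0.
  rewrite (@orbitE k) -/c; last by apply/andP; split; lra.
  by rewrite addrAC subrr add0r (W_periodic thps periodic).
have late x : c + 4 <= x -> exists n, 4 * (k + n).+1%:R <= x <= 4 * (k + n).+1%:R + 4.
  move=> cx; have [j /andP[j1 j2]] : exists j, 4 * j%:R <= x < 4 * j%:R + 4.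
    by apply: block_of; lra.
  have kj : (k < j)%N.
    rewrite -(ltr_nat R); have : (4 : R) * k%:R < 4 * j%:R by rewrite -/c; lra.
    by rewrite ltr_pM2l.
  by exists (j - k.+1)%N; rewrite -addSn subnKC // j1 ltW.
have c4 : x0 <= c + 4 <= c + 4 by rewrite lexx andbT ltW.
split.
  move=> eps eps0; have [d1 d10 H1] := period eps eps0.
  (* [eps] serves the incomplete first period, [r] starts the geometric decay, and [d1] controls all
     later periods. *)
  have e0 : 0 < Num.min eps (Num.min r d1) by rewrite !lt_min eps0 r0.
  have [d d0 H] := start _ e0; exists d; split => // z zs zd x x0x.
  have [xc|cx] := leP x (c + 4).
    have : `|z x - orbit x| < Num.min eps (Num.min r d1) by apply: H => //; rewrite x0x.
    by rewrite lt_min => /andP[].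
  have := H z zs zd _ c4; rewrite orbit4 !lt_min => /and3P[_ zr zd1].
  have [n xn] := late x (ltW cx); apply: (H1 z n zs) xn.
  apply: le_lt_trans (decay z zs zr n) (le_lt_trans _ zd1).
  by rewrite ler_piMl // exprn_ile1 // ltW.
have [d d0 H] := start r r0; exists d; split => // z zs zd.
have zr := H z zs zd _ c4; rewrite orbit4 in zr.
apply/cvgrPdist_lt => e e0; have [d1 d10 H1] := period e e0.
have [N _ HN] : \forall n \near \oo, q ^+ n < d1 / r.
  have /cvgrPdist_lt/(_ (d1 / r)) : (GRing.exp q : R ^nat) @ \oo --> 0.
    by apply: cvg_expr; rewrite ger0_norm.
  rewrite divr_gt0 // => /(_ isT); apply: filterS => n.
  by rewrite sub0r normrN ger0_norm // exprn_ge0.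
exists (4 * (k + N).+1%:R); split; first exact: num_real.
move=> x xN; rewrite sub0r normrN.
have [|n xn] := late x.
  apply: le_trans (ltW xN); rewrite -[(k + N).+1%:R]natr1 natrD; have := ler0n R N; rewrite /c; lra.
apply: (H1 z n zs _ x xn); apply: le_lt_trans (decay z zs zr n) _.
(* If n < N, the block containing x would end no later than 4(k + N + 1), which is less than x. *)
have Nn : (N <= n)%N.
  rewrite leqNgt; apply/negP => nN; have : (k + n).+2%:R <= (k + N).+1%:R :> R.
    by rewrite ler_nat ltnS -addnS leq_add2l.
  by rewrite -[(k + n).+2%:R]natr1; case/andP: xn => _; move: xN; lra.
have := HN n Nn; rewrite ltr_pdivlMr // => h.
by apply: le_lt_trans h; rewrite ler_wpM2l ?exprn_ge0 // ltW.
Qed.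

End PeriodicOrbit.

Theorem theorem1 (R : realType) :
  exists al : R, 0 < al /\
    forall a : R, 0 < a < al ->
      exists y : R -> R,
        is_solution a 0 y /\ non_sliding 0 y /\ four_periodic y /\
        loc_asympt_stable a y.
Proof.
have N0 : 0 < 600 * 500 :> R by lra.
exists (600 * 500)^-1; split; first by rewrite invr_gt0 N0.
move=> a /andP[a0 a1].
have small : 600 * 500 * a <= 1.
  by move: a1 N0; move: (600 * 500) => N a1 N0; rewrite mulrC -ler_pdivlMr // div1r ltW.
have [th [ps [t01 p01 per E]]] := crossings_exist a0 small.
have thps : crossing_pair a th ps by [].
exists (orbit a th ps); split; first exact: orbit_solution.
split; first exact: orbit_non_sliding.
by split; [exact: orbit_periodic|exact: orbit_stable].
Qed.
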